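(* Let $\mathbb{K}$ be a field, let $n\ge 3$ be an integer, and let $W_{n+1}$ denote the wheel graph on $n+1$ vertices. Then $$\mathrm{pd}(R_{W_{n+1}}/NI(W_{n+1}))=\begin{cases} a_{W_{n+1}} & \text{if } n\not\equiv 3\pmod 4,\\ a_{W_{n+1}}-1 & \text{if } n\equiv 3\pmod 4.\end{cases}$$
   Context: The wheel graph $W_{n+1}$ has vertex set $\{x,y_1,\ldots,y_n\}$ and edge set $\{\{x,y_i\}:1\le i\le n\}\cup\{\{y_j,y_{j+1}\}:1\le j\le n-1\}\cup\{\{y_1,y_n\}\}$. For a finite simple graph $H$, $R_H$ denotes the polynomial ring over $\mathbb{K}$ whose variables are the vertices of $H$ (standard grading). For $w\in V(H)$, $N_H[w]$ is the closed neighborhood of $w$ ($w$ together with all vertices adjacent to $w$) and $m_{(H,w)}=\prod_{z\in N_H[w]}z\in R_H$. The closed neighborhood ideal is $NI(H)=\langle m_{(H,w)} : w\in V(H)\rangle\subseteq R_H$. A matching of $H$ is a set of pairwise disjoint edges; the matching number $a_H$ is the maximum size of a matching. $\mathrm{pd}(R_H/I)=\max\{i:\beta_{i,j}(R_H/I)\ne 0\text{ for some }j\}$ is the projective dimension of $R_H/I$ over $R_H$, where $\beta_{i,j}$ denotes graded Betti numbers. *)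

(* Defs.v *)
From mathcomp Require Import all_boot all_order all_algebra.
From mathcomp Require Import mpoly.

Set Implicit Arguments.
Unset Strict Implicit.
Unset Printing Implicit Defensive.

Import GRing.Theory.
Local Open Scope ring_scope.

Section Graph.
Variables (V : finType) (e : rel V).

Definition closed_nbhd (w : V) : {set V} := [set z | (z == w) || e w z].

Definition edges : {set {set V}} :=
  [set A | [exists u, exists v, e u v && (A == [set u; v])]].

Definition is_matching (M : {set {set V}}) : bool :=
  (M \subset edges) && trivIset M.

Definition matching_number : nat :=
  (\max_(M : {set {set V}} | is_matching M) #|M|)%N.

End Graph.

(* [None] is the hub x and [Some i] is the rim vertex y_{i+1}. *)
Definition wheel (n : nat) : rel (option 'I_n) := fun u v =>
  match u, v with
  | None, None => false
  | None, Some _ | Some _, None => true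
  | Some i, Some j =>
      [|| (j == i.+1 :> nat), (i == j.+1 :> nat),
          (i == 0%N :> nat) && (j.+1 == n) | (j == 0%N :> nat) && (i.+1 == n)]
  end.
Arguments wheel : clear implicits.

Lemma wheel_sym n u v : wheel n u v = wheel n v u.
Proof. by case: u v => [i|] [j|] //=; rewrite orbCA; do 2!congr orb; rewrite orbC. Qed.

Lemma wheel_irrefl n : (2 <= n)%N -> irreflexive (wheel n).
Proof.
move=> n_ge2 [i|] //=; rewrite ltn_eqF //= orbb.
by apply/negP => /andP[/eqP-> /eqP n1]; rewrite -n1 in n_ge2.
Qed.

Section Ideal.
Variables (K : fieldType) (V : finType).

Definition vertex_ring := {mpoly K[#|V|]}.

Definition vertex_var (z : V) : vertex_ring := 'X_(enum_rank z).

Definition nbhd_monomial (e : rel V) (w : V) : vertex_ring :=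
  \prod_(z in closed_nbhd e w) vertex_var z.

Definition ideal_generated (N : nat) (g : V -> {mpoly K[N]})
    (f : {mpoly K[N]}) : Prop :=
  exists c : V -> {mpoly K[N]}, f = \sum_w c w * g w.

Definition closed_nbhd_ideal (e : rel V) : vertex_ring -> Prop :=
  ideal_generated (nbhd_monomial e).

End Ideal.
Arguments closed_nbhd_ideal K {V} e f : rename.

Section Resolution.
Variables (K : fieldType) (N : nat).
Local Notation R := {mpoly K[N]}.

(* The minimal graded free resolutions
     ... -> F_2 -> F_1 -> F_0 -> R/I -> 0
   of R/I over R.  F_i has a basis indexed by 'I_(mfr_rank i), whose a-th
   element has degree [mfr_deg i a], so that F_i is the sum of the R(- mfr_deg i a).
   Elements of F_i are row vectors; the differential F_{i+1} -> F_i is right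
   multiplication by [mfr_diff i], and F_0 -> R/I is right multiplication by
   [mfr_aug], followed by the projection R -> R/I. *)
Record minimal_free_resolution (I : R -> Prop) := MinimalFreeResolution {
  mfr_rank : nat -> nat;
  mfr_deg : forall i, 'I_(mfr_rank i) -> int;
  mfr_diff : forall i, 'M[R]_(mfr_rank i.+1, mfr_rank i);
  mfr_aug : 'cV[R]_(mfr_rank 0);
  mfr_diff_homog : forall i a b m, m \in msupp (mfr_diff i a b) ->
    (mdeg m)%:Z + mfr_deg b = mfr_deg a;
  mfr_aug_homog : forall a m, m \in msupp (mfr_aug a 0) ->
    (mdeg m)%:Z = mfr_deg a;
  mfr_aug_surj : forall f : R, exists u : 'rV[R]_(mfr_rank 0),
    I (f - (u *m mfr_aug) 0 0);
  mfr_exact0 : forall u : 'rV[R]_(mfr_rank 0),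
    I ((u *m mfr_aug) 0 0) <-> exists v, u = v *m mfr_diff 0;
  mfr_exactS : forall i (u : 'rV[R]_(mfr_rank i.+1)),
    u *m mfr_diff i = 0 <-> exists v, u = v *m mfr_diff i.+1;
  mfr_minimal : forall i a b, (mfr_diff i a b)@_0%MM = 0
}.

(* A relation standing for beta_{i,j}(R/I) = b.  Minimal graded free resolutions are
   unique up to isomorphism, so b is determined by I, i and j. *)
Definition graded_betti (I : R -> Prop) (i : nat) (j : int) (b : nat) : Prop :=
  exists F : minimal_free_resolution I,
    b = #|[set a : 'I_(mfr_rank F i) | mfr_deg a == j]|.

Definition proj_dim (I : R -> Prop) (p : nat) : Prop :=
  (exists j b, graded_betti I p j b /\ b <> 0%N) /\
  (forall i j b, graded_betti I i j b -> b <> 0%N -> (i <= p)%N).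

End Resolution.

(* Main.v *)
(* A squarefree monomial ideal is encoded by the up-closed family of the supports of its
   monomials, and a multigraded free resolution of it by scalar matrices, exactness being
   tested in every squarefree multidegree. NI(W_{n+1}) is the hub
   times the ideal J of the 3-paths of the cycle C_n. A mapping cone turns resolutions of
   R/J and R/(J : m) into one of R/(J + m). When the generators of J are added one by one,
   each colon ideal is the 3-path ideal of a shorter path, possibly with the edge at one end
   as an extra generator, plus at most two variables. By induction on n, this gives a resolution of length
   p = 2 (n / 4) + [4 does not divide n] all of whose basis elements of full multidegree
   lie in homological degree p. Hence cancelling the unit entries of the differential,
   which pairs elements of equal multidegree in consecutive homological degrees, yields a
   minimal resolution of length exactly p. Every other minimal resolution is compared with
   it by lifting chain maps: modulo the variables, the identity of its i-th module is the
   composite through the i-th module of the first one. Finally the matching number of the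
   wheel is the integer part of (n + 1) / 2. *)
Require Import Defs.
From mathcomp Require Import all_boot all_order all_algebra.
From mathcomp Require Import mpoly.
From mathcomp Require Import zify ring.

Set Implicit Arguments.
Unset Strict Implicit.
Unset Printing Implicit Defensive.

Import GRing.Theory.
Local Open Scope ring_scope.

(** * Resolutions of squarefree monomial ideals *)

Lemma sum_neq0 (R : nmodType) (T : finType) (F : T -> R) :
  \sum_x F x != 0 -> exists x, F x != 0.
Proof.
move=> nz; apply/existsP; apply: contraNT nz => /existsPn F0.
by rewrite big1 // => x _; apply/eqP; rewrite -[_ == _]negbK F0.
Qed.

Section SetResolution.
Variables (K : fieldType) (V : finType).
Implicit Types (I J : pred {set V}) (G S T m : {set V}).

(** A vector in squarefree multidegree [G]: [x] contributes only if its multidegree divides [G], and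
    then by one scalar, the coefficient of the monomial of [G :\: al x]. *)
Definition supported (X : finType) (A : {set X}) (al : X -> {set V}) G
  (u : X -> K) := forall x, u x != 0 -> (x \in A) && (al x \subset G).

(* The basis is [A]. Its element x has homological degree [h x] and multidegree [al x], and
   the entry of the differential at (x, y) is [c x y] times the monomial of [al x :\: al y].
   Vectors are rows; [sr_exact] is exactness in multidegree [G] at all homological degrees
   at once, [x0] being the generator in degree 0. *)
Record set_resolution I (X : finType) (A : {set X}) (h : X -> nat)
    (al : X -> {set V}) (c : X -> X -> K) (x0 : X) : Prop := SetResolution {
  sr_mono : forall S T, S \subset T -> I S -> I T;
  sr_supp : forall x y, c x y != 0 ->
    [/\ x \in A, y \in A, h x = (h y).+1 & al y \subset al x];
  sr_x0 : x0 \in A;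
  sr_al0 : al x0 = set0;
  sr_h0 : forall x, x \in A -> (h x == 0%N) = (x == x0);
  sr_cc : forall x z, \sum_y c x y * c y z = 0;
  sr_aug : forall x, c x x0 != 0 -> I (al x);
  sr_exact : forall G u, supported A al G u ->
    (forall z, \sum_x u x * c x z = 0) -> (u x0 != 0 -> I G) ->
    exists2 v, supported A al G v & forall z, u z = \sum_x v x * c x z
}.

(** The ideal quotient by the monomial of [m] and the sum with it, on supports: multiplying by that
    monomial turns the support [G] into [G :|: m]. *)
Definition colon J m : pred {set V} := fun G => J (G :|: m).
Definition adjoin J m : pred {set V} := fun G => J G || (m \subset G).

Section Theory.
Variables (I : pred {set V}) (X : finType) (A : {set X}) (h : X -> nat).
Variables (al : X -> {set V}) (c : X -> X -> K) (x0 : X).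
Hypothesis F : set_resolution I A h al c x0.

Lemma sr_row0 z : c x0 z = 0.
Proof.
apply/eqP; apply: contraTT (sr_x0 F) => /(sr_supp F)[Ax _ hx _].
by have := sr_h0 F Ax; rewrite hx eqxx.
Qed.

(** The differential lowers [h] by one, so only the part of a preimage in degree [k.+1] matters and
    the rest can be set to zero. *)
Lemma sr_exact_homog k G u : supported A al G u ->
  (forall x, u x != 0 -> h x = k) ->
  (forall z, \sum_x u x * c x z = 0) -> (u x0 != 0 -> I G) ->
  exists v, [/\ supported A al G v, forall x, v x != 0 -> h x = k.+1
    & forall z, u z = \sum_x v x * c x z].
Proof.
move=> su hu uc u0; have [v sv uE] := sr_exact F su uc u0.
exists (fun x => if h x == k.+1 then v x else 0); split.
- by move=> x /=; case: ifP => [_ /sv//|_]; rewrite eqxx.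
- by move=> x /=; case: ifP => [/eqP//|_]; rewrite eqxx.
move=> z; case: (eqVneq (h z) k) => [hz|hz].
  rewrite uE; apply: eq_bigr => x _; case: ifP => // /negbT hx.
  rewrite mul0r; case: (eqVneq (c x z) 0) => [->|/(sr_supp F)[_ _ hx' _]].
    by rewrite mulr0.
  by rewrite hx' hz eqxx in hx.
case: (eqVneq (u z) 0) => [->|/hu /eqP]; last by rewrite (negPf hz).
apply/esym/big1 => x _; case: (eqVneq (c x z) 0) => [->|/(sr_supp F)[_ _ hx' _]].
  by rewrite mulr0.
by rewrite hx' eqSS (negPf hz) mul0r.
Qed.

End Theory.

(** * Mapping cones *)

Section Cone.
Variables (J : pred {set V}) (m : {set V}).
Variables (XG : finType) (AG : {set XG}) (hG : XG -> nat).
Variables (aG : XG -> {set V}) (cG : XG -> XG -> K) (zG : XG).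
Variables (XH : finType) (AH : {set XH}) (hH : XH -> nat).
Variables (aH : XH -> {set V}) (cH : XH -> XH -> K) (zH : XH).
Hypothesis G : set_resolution J AG hG aG cG zG.
Hypothesis H : set_resolution (colon J m) AH hH aH cH zH.

(** Multiplication by the monomial of [m] maps R/(J : m) to R/J. Here [phi] lifts it to the
    resolutions, commuting with the differentials up to degree [k]; hence the shift by [m] in the
    multidegrees. *)
Definition lifts_upto k (phi : XH -> XG -> K) :=
  [/\ forall x z, phi x z != 0 ->
        [/\ x \in AH, z \in AG, hG z = hH x & aG z \subset aH x :|: m],
      forall z, phi zH z = (z == zG)%:R
    & forall x z, (hH x <= k)%N ->
        \sum_w phi x w * cG w z = \sum_y cH x y * phi y z].

(** Generator goes to generator in degree 0. In degree [k.+1], the image under [phi] of the boundary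
    of [x] is a cycle of [G], and exactness supplies the row of [x]. *)
Lemma lift_upto k : exists phi, lifts_upto k phi.
Proof.
have hzG : hG zG = 0%N by apply/eqP; rewrite (sr_h0 G) ?(sr_x0 G).
have hzH : hH zH = 0%N by apply/eqP; rewrite (sr_h0 H) ?(sr_x0 H).
elim: k => [|k [phi [sphi phi0 phiE]]].
  exists (fun x z => ((x == zH) && (z == zG))%:R); split.
  - move=> x z; case: andP => [[/eqP-> /eqP->] _|]; last by rewrite eqxx.
    by rewrite (sr_x0 G) (sr_x0 H) hzG hzH (sr_al0 G) sub0set.
  - by move=> z; rewrite eqxx.
  move=> x z; rewrite leqn0 => hx; rewrite !big1 // => y _.
    case: (eqVneq (cH x y) 0) => [->|/(sr_supp H)[_ _ hx' _]]; first by rewrite mul0r.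
    by rewrite hx' in hx.
  by case: andP => [[_ /eqP->]|_]; rewrite ?mul0r // (sr_row0 G) mulr0.
have lift x : exists v : XG -> K, hH x = k.+1 ->
    [/\ supported AG aG (aH x :|: m) v, forall z, v z != 0 -> x \in AH /\ hG z = k.+1
      & forall z, \sum_y cH x y * phi y z = \sum_w v w * cG w z].
  case: (eqVneq (hH x) k.+1) => [hx|/eqP hx]; last by exists (fun=> 0).
  case: (boolP (x \in AH)) => [Ax|nAx]; last first.
    exists (fun=> 0) => _; split=> [z|z|z]; rewrite ?eqxx // !big1 // => y _.
      by rewrite mul0r.
    case: (eqVneq (cH x y) 0) => [->|/(sr_supp H)[Ax _ _ _]]; first by rewrite mul0r.
    by rewrite Ax in nAx.
  have [||||v [sv hv vE]] := @sr_exact_homog _ _ _ _ _ _ _ G k (aH x :|: m)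
    (fun z => \sum_y cH x y * phi y z).
  - move=> z /sum_neq0[y]; rewrite mulf_eq0 negb_or => /andP[/(sr_supp H)[_ _ _ sa]].
    move=> /sphi[_ -> _ sz] /=; apply: subset_trans sz _.
    exact: setSU.
  - move=> z /sum_neq0[y]; rewrite mulf_eq0 negb_or => /andP[/(sr_supp H)[_ _ hy _]].
    by move=> /sphi[_ _ -> _]; move: hy; rewrite hx => -[].
  - move=> z; under eq_bigr do rewrite mulr_suml.
    rewrite exchange_big /=.
    transitivity (\sum_y cH x y * \sum_t cH y t * phi t z); last first.
      under eq_bigr do rewrite mulr_sumr.
      rewrite exchange_big big1 //= => t _.
      under eq_bigr do rewrite mulrA.
      by rewrite -mulr_suml (sr_cc H) mul0r.
    apply: eq_bigr => y _; under eq_bigr do rewrite -mulrA.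
    rewrite -mulr_sumr; case: (eqVneq (cH x y) 0) => [->|/(sr_supp H)[_ _ hy _]].
      by rewrite !mul0r.
    by rewrite phiE //; move: hy; rewrite hx => -[<-].
  (* Only [y = zH] can contribute at [zG], and for it the augmentation condition of [H] says
     precisely that [aH x :|: m] belongs to [J]. *)
  - move=> /sum_neq0[y]; rewrite mulf_eq0 negb_or => /andP[cxy].
    move=> /sphi[Ay _]; rewrite hzG => /esym /eqP; rewrite (sr_h0 H Ay) => /eqP yE _.
    by apply: (sr_aug H); rewrite -yE.
  exists v => _; split=> //.
  by move=> z vz; split=> //; apply: hv.
have [v vP] := fin_all_exists lift.
exists (fun x z => if hH x == k.+1 then v x z else phi x z); split.
- move=> x z; case: ifP => [/eqP hx vz|_ /sphi//].
  have [sv hv _] := vP x hx; have [-> hz] := hv _ vz.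
  by have /andP[-> ->] := sv _ vz; rewrite hz hx.
- by move=> z; rewrite hzH /= phi0.
move=> x z; rewrite leq_eqVlt ltnS; case: eqP => /= [hx _|_ hx].
  have [_ _ <-] := vP x hx; apply: eq_bigr => y _.
  case: (eqVneq (cH x y) 0) => [->|/(sr_supp H)[_ _ hy _]]; first by rewrite !mul0r.
  by move: hy; rewrite hx => -[<-]; rewrite ltn_eqF.
rewrite phiE //; apply: eq_bigr => y _.
case: (eqVneq (cH x y) 0) => [->|/(sr_supp H)[_ _ hy _]]; first by rewrite !mul0r.
by rewrite ltn_eqF // -hy ltnW // ltnS.
Qed.

Lemma lift_total : exists phi : XH -> XG -> K,
  [/\ forall x z, phi x z != 0 ->
        [/\ x \in AH, z \in AG, hG z = hH x & aG z \subset aH x :|: m],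
      forall z, phi zH z = (z == zG)%:R
    & forall x z, \sum_w phi x w * cG w z = \sum_y cH x y * phi y z].
Proof.
have [phi [? ? phiE]] := lift_upto (\max_x hH x).
by exists phi; split=> // x z; apply: phiE; apply: leq_bigmax.
Qed.

(** The basis of the cone: that of [H], moved up one homological degree and multiplied by [m], next
    to that of [G]. *)
Let hC (x : XH + XG) := match x with inl y => (hH y).+1 | inr z => hG z end.
Let aC (x : XH + XG) := match x with inl y => aH y :|: m | inr z => aG z end.
Let AC := [set x : XH + XG |
  match x with inl y => y \in AH | inr z => z \in AG end].

Lemma mapping_cone : exists c : XH + XG -> XH + XG -> K,
  set_resolution (adjoin J m) AC hC aC c (inr zG).
Proof.
have [phi [sphi phi0 phiE]] := lift_total.
(* The sign on [cH] makes the two mixed terms of the squared differential cancel. *)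
pose c (x y : XH + XG) := match x, y with
  | inl x, inl y => - cH x y | inl x, inr z => phi x z
  | inr x, inr z => cG x z | inr _, inl _ => 0 end.
have sumC (f : XH + XG -> K) : \sum_x f x = \sum_x f (inl x) + \sum_x f (inr x).
  by rewrite big_sumType.
exists c; split.
- move=> S T sST /orP[/(sr_mono G sST) JT|mS]; apply/orP; [by left|right].
  exact: subset_trans sST.
- move=> [x|x] [y|y] /=; rewrite !inE ?eqxx //.
  + by rewrite oppr_eq0 => /(sr_supp H)[-> -> -> /setSU->].
  + by move=> /sphi[-> -> -> ->].
  + by move=> /(sr_supp G).
- by rewrite inE (sr_x0 G).
- exact: (sr_al0 G).
- case=> x; rewrite inE => Ax; first by apply/esym/negbTE.
  exact: (sr_h0 G).
- move=> [x|x] [z|z]; rewrite sumC /=.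
  + rewrite [X in _ + X]big1 ?addr0 => [|y _]; last by rewrite mulr0.
    by under eq_bigr do rewrite mulrNN; rewrite (sr_cc H).
  + by under eq_bigr do rewrite mulNr; rewrite sumrN phiE addNr.
  + by rewrite !big1 ?addr0 // => y _; rewrite ?mul0r ?mulr0.
  + by rewrite (sr_cc G) big1 ?add0r // => y _; rewrite mul0r.
- move=> [x|x] /=; rewrite /adjoin.
    by rewrite subsetUr orbT.
  by move=> /(sr_aug G)->.
move=> S u su uc u0.
have uH z : \sum_x u (inl x) * cH x z = 0.
  have := uc (inl z); rewrite sumC /= [X in _ + X]big1 ?addr0 => [|y _]; last first.
    by rewrite mulr0.
  by under eq_bigr do rewrite mulrN; rewrite sumrN => /eqP; rewrite oppr_eq0 => /eqP.
have uG z : \sum_x u (inl x) * phi x z + \sum_x u (inr x) * cG x z = 0.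
  by have := uc (inr z); rewrite sumC.
have suG : supported AG aG S (u \o inr).
  by move=> x /su; rewrite inE.
(* Every multidegree of the shifted copy of [H] contains [m]; if [S] does not, [u] lives on [G]
   alone. *)
case: (boolP (m \subset S)) => [mS|nmS]; last first.
  have uH0 x : u (inl x) = 0.
    apply: contraNeq nmS => /su /andP[_ /=]; apply: subset_trans.
    exact: subsetUr.
  have [||v sv vE] := sr_exact G suG.
  - move=> z; have := uG z; rewrite [X in X + _]big1 ?add0r // => y _.
    by rewrite uH0 mul0r.
  - by move=> /u0; rewrite /adjoin (negPf nmS) orbF.
  exists (fun x => match x with inl _ => 0 | inr z => v z end).
    by move=> [x|x] /=; rewrite ?eqxx // inE => /sv.
  move=> z; rewrite sumC /= [X in X + _]big1 ?add0r; last by move=> y _; rewrite mul0r.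
  case: z => z /=; last exact: vE.
  by rewrite uH0 big1 // => y _; rewrite mulr0.
have suH : supported AH aH S (u \o inl).
  by move=> x /su; rewrite inE /= => /andP[-> /=]; apply: subset_trans (subsetUl _ _).
have [//||v sv vE] := sr_exact H suH.
  (* At [zG] the cycle equation says that [u (inl zH)] is minus the boundary coefficient of the [G]
     part. If it is nonzero, some [aG x] inside [S] is in [J], hence so is [S]. *)
  rewrite /= => u1; have : \sum_x u (inr x) * cG x zG != 0.
    rewrite -(addKr (\sum_x u (inl x) * phi x zG) (\sum_x u (inr x) * cG x zG)).
    rewrite uG addr0 oppr_eq0 (bigD1 zH) //= phi0 eqxx mulr1 big1 ?addr0 // => x xz.
    case: (eqVneq (phi x zG) 0) => [->|/sphi[Ax _]]; first by rewrite mulr0.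
    have /eqP -> : hG zG == 0%N by rewrite (sr_h0 G) ?(sr_x0 G).
    by move=> /esym/eqP; rewrite (sr_h0 H) // (negPf xz).
  move=> /sum_neq0[x]; rewrite mulf_eq0 negb_or => /andP[/suG/andP[_ aS]].
  by move=> /(sr_aug G); apply: (sr_mono G); apply: subset_trans aS (subsetUl _ _).
(* The coefficient of v at the generator of degree 0 is free: its row in cH is zero. *)
pose v' x := if x == zH then u (inr zG) else - v x.
have v'E z : u (inl z) = - \sum_x v' x * cH x z.
  rewrite [LHS]vE -sumrN; apply: eq_bigr => x _; rewrite /v'.
  by case: eqP => [->|_]; rewrite ?(sr_row0 H) ?mulr0 ?oppr0 // mulNr opprK.
have v'phi : \sum_x v' x * phi x zG = u (inr zG).
  rewrite (bigD1 zH) //= /v' eqxx phi0 eqxx mulr1 big1 ?addr0 // => x xz.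
  case: (eqVneq (phi x zG) 0) => [->|/sphi[Ax _]]; first by rewrite mulr0.
  have /eqP -> : hG zG == 0%N by rewrite (sr_h0 G) ?(sr_x0 G).
  by move=> /esym/eqP; rewrite (sr_h0 H) // (negPf xz).
have sv' : supported AH aH S v'.
  move=> x; rewrite /v'; case: ifP => [/eqP-> _|_].
    by rewrite (sr_x0 H) (sr_al0 H) sub0set.
  by rewrite oppr_eq0 => /sv.
(* Without the contribution of [v'], the [G] part is a cycle, and its coefficient at [zG] vanishes
   by the choice of [v' zH], so the augmentation condition is vacuous. *)
have [|||w sw wE] := @sr_exact _ _ _ _ _ _ _ G S
  (fun z => u (inr z) - \sum_x v' x * phi x z).
- move=> z; case: (eqVneq (u (inr z)) 0) => [->|/suG //].
  rewrite sub0r oppr_eq0 => /sum_neq0[x]; rewrite mulf_eq0 negb_or.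
  move=> /andP[/sv' /andP[_ aS]] /sphi[_ -> _ sz] /=.
  by apply: subset_trans sz _; rewrite subUset aS.
- move=> z; under eq_bigr do rewrite mulrBl mulr_suml.
  rewrite sumrB exchange_big /=.
  have -> : \sum_j \sum_i v' j * phi j i * cG i z = - \sum_x u (inl x) * phi x z.
    under eq_bigr do (under eq_bigr do rewrite -mulrA; rewrite -mulr_sumr phiE mulr_sumr).
    rewrite exchange_big -sumrN; apply: eq_bigr => y _ /=.
    by rewrite v'E mulNr opprK mulr_suml; apply: eq_bigr => x _; rewrite mulrA.
  by rewrite opprK addrC uG.
- by rewrite v'phi subrr eqxx.
exists (fun x => match x with inl y => v' y | inr z => w z end).
  case=> x /=; rewrite inE; last by move/sw.
  by move=> /sv'/andP[-> aS]; rewrite /= subUset aS mS.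
move=> [z|z]; rewrite sumC /=.
  rewrite [X in _ + X]big1 ?addr0 => [|y _]; last by rewrite mulr0.
  by rewrite v'E -sumrN; apply: eq_bigr => x _; rewrite mulrN.
by rewrite -wE addrC subrK.
Qed.

End Cone.

(** Only the set of bidegrees of the basis is kept, without multiplicities: bounds and the
    occurrence of one bidegree are all that is read off later. *)
Definition resolved I (s : seq (nat * {set V})) :=
  exists (X : finType) (A : {set X}) h al c x0,
    set_resolution I A h al c x0 /\ [seq (h x, al x) | x in A] =i s.

Lemma eq_resolved I J s t : I =1 J -> s =i t -> resolved I s -> resolved J t.
Proof.
move=> eIJ est [X [A [h [al [c [x0 [F Fs]]]]]]].
exists X, A, h, al, c, x0; split; last by move=> z; rewrite Fs est.
split; try by case: F.
- by move=> S T sST; rewrite -!eIJ; apply: sr_mono F _ _ sST.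
- by move=> x; rewrite -eIJ; apply: sr_aug F x.
by move=> G u su uc u0; apply: (sr_exact F) => // /u0; rewrite eIJ.
Qed.

Lemma resolved0 : resolved pred0 [:: (0%N, set0)].
Proof.
exists unit, setT, (fun=> 0%N), (fun=> set0), (fun _ _ => 0), tt; split.
  split=> //.
  - by move=> x y; rewrite eqxx.
  - by move=> x z; rewrite big1 // => y _; rewrite mul0r.
  - by move=> x; rewrite eqxx.
  move=> G u _ _ u0; exists (fun=> 0); first by move=> x; rewrite eqxx.
  move=> [/=]; rewrite big1 => [|y _]; last by rewrite mul0r.
  by apply/eqP; apply: contraT => /u0.
move=> z; rewrite inE; apply/imageP/eqP => [[x _ ->]//|->].
by exists tt.
Qed.

Definition shift m (x : nat * {set V}) := (x.1.+1, x.2 :|: m).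

Lemma resolved_adjoin J m s t : resolved J s -> resolved (colon J m) t ->
  resolved (adjoin J m) (s ++ map (shift m) t).
Proof.
move=> [XG [AG [hG [aG [cG [zG [G Gs]]]]]]] [XH [AH [hH [aH [cH [zH [H Hs]]]]]]].
have [c C] := mapping_cone G H.
do 6!eexists; split; first exact: C.
move=> z; rewrite mem_cat -Gs; apply/imageP/orP.
  move=> [[x|x]]; rewrite inE => Ax ->; [right|left]; last by apply/imageP; exists x.
  apply/mapP; exists (hH x, aH x) => //.
  by rewrite -Hs; apply/imageP; exists x.
case=> [/imageP[x Ax ->]|/mapP[y]]; first by exists (inr x); rewrite ?inE.
rewrite -Hs => /imageP[x Ax ->] ->; exists (inl x) => //.
by rewrite inE.
Qed.

End SetResolution.

(** * Paths and cycles *)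

Lemma disjoint_notinP (T : finType) (A B : {set T}) :
  reflect (forall x, x \in A -> x \notin B) [disjoint A & B].
Proof.
rewrite disjoints_subset; apply: (iffP subsetP) => AB x /AB; by rewrite inE.
Qed.

(** * Homological degrees of the basis elements of full multidegree *)

Section Profiles.
Variables (K : fieldType) (V : finType).
Implicit Types (I J : pred {set V}) (G S T m Y : {set V}).

(** Multiplication by [z] identifies I with zI up to a shift, so the same scalar matrices work once
    [z] is put into every multidegree of positive homological degree. *)
Lemma resolved_hub I z s : resolved K I s ->
  resolved K (fun G => (z \in G) && I G)
    [seq if x.1 == 0%N then x else (x.1, z |: x.2) | x <- s].
Proof.
move=> [X [A [h [al [c [x0 [F Fs]]]]]]].
pose al' x := if h x == 0%N then al x else z |: al x.
have h0 : h x0 = 0%N by apply/eqP; rewrite (sr_h0 F) ?(sr_x0 F).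
exists X, A, h, al', c, x0; split; last first.
  move=> w; apply/imageP/mapP => [[x Ax ->]|[y]].
    exists (h x, al x); first by rewrite -Fs; apply/imageP; exists x.
    by rewrite /al' /=; case: ifP.
  rewrite -Fs => /imageP[x Ax ->] -> /=; exists x => //.
  by rewrite /al'; case: ifP.
split.
- move=> S T sST /andP[zS IS]; rewrite (subsetP sST) //=.
  exact: (sr_mono F) IS.
- move=> x y /(sr_supp F)[Ax Ay hx sa]; split=> //.
  rewrite /al' hx /=; case: ifP => _; last exact: setUS.
  exact: subset_trans sa (subsetUr _ _).
- exact: sr_x0 F.
- by rewrite /al' h0 (sr_al0 F).
- exact: sr_h0 F.
- exact: sr_cc F.
- move=> x cx; have [_ _ hx _] := sr_supp F cx.
  rewrite /al' hx /= setU11 /=; apply: (sr_mono F) (sr_aug F cx).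
  exact: subsetUr.
(* If [z] is not in [G], only [x0] lives in multidegree [G], and the augmentation condition kills
   its coefficient. *)
move=> G u su uc u0; case: (boolP (z \in G)) => zG; last first.
  exists (fun=> 0); first by move=> x; rewrite eqxx.
  move=> x; rewrite big1 => [|y _]; last by rewrite mul0r.
  apply/eqP; apply: contraT => ux; have /andP[Ax] := su x ux.
  rewrite /al'; case: ifP => [|_]; last by rewrite subUset sub1set (negPf zG).
  rewrite (sr_h0 F Ax) => /eqP xE.
  by move: u0; rewrite -xE (negPf zG) => /(_ ux).
have sal x : (al' x \subset G) = (al x \subset G).
  by rewrite /al'; case: ifP => // _; rewrite subUset sub1set zG.
have [|//||v sv vE] := @sr_exact _ _ _ _ _ _ _ _ _ F G u.
- by move=> x /su; rewrite sal.
- by move=> /u0; rewrite zG.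
by exists v => // x /sv; rewrite sal.
Qed.

(* The bound [b] on the homological degrees is attained by every basis element of
   full multidegree [Y]; such an element exists iff [e]. *)
Definition concentrated I Y b (e : bool) := exists s, [/\ resolved K I s,
  forall x, x \in s -> [/\ x.1 <= b, x.2 \subset Y & x.2 = Y -> x.1 = b /\ e]%N
  & e -> (b, Y) \in s].

Lemma eq_concentrated I J Y b e : I =1 J ->
  concentrated I Y b e -> concentrated J Y b e.
Proof. by move=> eIJ [s [rs *]]; exists s; split=> //; apply: eq_resolved rs. Qed.

Lemma concentrated0 : concentrated pred0 set0 0 true.
Proof.
exists [:: (0%N, set0)]; split; [exact: resolved0| |by rewrite inE].
by move=> x; rewrite inE => /eqP->.
Qed.

Lemma concentrated_widen I Y b e Y' b' : (b <= b')%N -> Y \proper Y' ->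
  concentrated I Y b e -> concentrated I Y' b' false.
Proof.
move=> bb' /andP[YY' nYY'] [s [rs ss _]]; exists s; split=> // x /ss[xb xY _].
split; [exact: leq_trans bb'|exact: subset_trans YY'|].
by move=> xE; rewrite -xE xY in nYY'.
Qed.

(** In the cone, a basis element of full multidegree comes either from [J], when [Y1 = Y], or from
    the colon ideal, where disjointness from [m] forces full multidegree [Y2] before the shift. The
    last two hypotheses put both kinds in degree [b]. *)
Lemma concentrated_adjoin J m Y1 b1 e1 Y2 b2 e2 Y b :
  concentrated J Y1 b1 e1 -> concentrated (colon J m) Y2 b2 e2 ->
  Y1 \subset Y -> Y2 :|: m = Y -> [disjoint Y2 & m] ->
  (b1 <= b)%N -> (b2 < b)%N -> (Y1 = Y -> e1 -> b1 = b) -> (e2 -> b2.+1 = b) ->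
  concentrated (adjoin J m) Y b ((Y1 == Y) && e1 || e2).
Proof.
move=> [s [rs ss es]] [t [rt st et]] Y1Y Y2Y dY b1b b2b H1 H2.
exists (s ++ map (shift m) t); split; first exact: resolved_adjoin.
  move=> x; rewrite mem_cat => /orP[/ss[xb xY xE]|/mapP[w /st[wb wY wE] ->]].
    split; [exact: leq_trans b1b|exact: subset_trans Y1Y|].
    move=> xYE; have Y1E : Y1 = Y by apply/eqP; rewrite eqEsubset Y1Y -xYE.
    have [|-> E1] := xE; first by rewrite Y1E.
    by rewrite Y1E eqxx E1; split=> //; apply: H1.
  rewrite /shift /=; split; first exact: leq_trans b2b.
    by rewrite -Y2Y setSU.
  move=> wYE; have [|-> E2] := wE.
    apply/eqP; rewrite eqEsubset wY; apply/subsetP => v vY2.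
    have : v \in Y by rewrite -Y2Y inE vY2.
    rewrite -wYE inE => /orP[//|vm].
    by move/disjoint_notinP: dY => /(_ v vY2); rewrite vm.
  by rewrite E2 orbT H2.
case/orP => [/andP[/eqP Y1E E1]|E2]; rewrite mem_cat.
  by rewrite -Y1E -(H1 Y1E E1) es.
apply/orP; right; apply/mapP; exists (b2, Y2); first exact: et.
by rewrite /shift /= Y2Y H2.
Qed.

(** Since [z] does not occur in [J], the colon ideal is [J] itself; full multidegree then arises
    only in the shifted copy, one degree higher. *)
Lemma concentrated_var J Y b e z : z \notin Y ->
  (forall G, J (G :|: [set z]) = J G) ->
  concentrated J Y b e -> concentrated (adjoin J [set z]) (z |: Y) b.+1 e.
Proof.
move=> zY Jz cJ; have cJ' : concentrated (colon J [set z]) Y b e.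
  by apply: eq_concentrated cJ => G; rewrite /colon Jz.
have nE : (Y == z |: Y) = false.
  by apply/negbTE; apply: contraNneq zY => ->; rewrite setU11.
have := @concentrated_adjoin _ _ _ _ _ _ _ _ (z |: Y) b.+1 cJ cJ'.
rewrite nE /=; apply=> //; first exact: subsetUr.
- by rewrite setUC.
- by rewrite disjoint_sym disjoints1.
by move=> /eqP; rewrite nE.
Qed.

(** The generator in degree 0 does not acquire [z]; [0 < b] ensures that the elements of multidegree
    [Y] do. *)
Lemma concentrated_hub I Y b e z : z \notin Y -> (0 < b)%N ->
  concentrated I Y b e ->
  concentrated (fun G => (z \in G) && I G) (z |: Y) b e.
Proof.
move=> zY b0 [s [rs ss es]].
exists [seq if x.1 == 0%N then x else (x.1, z |: x.2) | x <- s].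
split; first exact: resolved_hub.
  move=> _ /mapP[x /ss[xb xY xE] ->]; case: eqP => _ /=; last first.
    split=> //; first exact: setUS.
    move=> E; apply: xE; apply/setP => v; move/setP/(_ v): E; rewrite !inE.
    case: eqVneq => [-> _|//]; rewrite (negPf zY).
    by apply/negbTE; apply: contra zY; apply: (subsetP xY).
  split=> //; first exact: subset_trans xY (subsetUr _ _).
  by move=> E; rewrite E subUset sub1set (negPf zY) in xY.
move=> /es bY; apply/mapP; exists (b, Y) => //=.
by rewrite eqn0Ngt b0.
Qed.

End Profiles.

(** * 3-path ideals of paths and cycles *)

Section Path.
Variable (V : finType).
Implicit Types (y : nat -> V) (G : {set V}).

Definition window y i : {set V} := [set y i; y i.+1; y i.+2].

Definition path_family y k : pred {set V} :=
  fun G => [exists i : 'I_k, (i.+2 < k)%N && (window y i \subset G)].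

(** The 3-path ideal of the path on [k] vertices plus its last edge. That edge divides the last
    window, so only windows in the first [k.-1] vertices are listed. *)
Definition edge_path_family y k : pred {set V} :=
  fun G => path_family y k.-1 G ||
    (1 < k)%N && ([set y k.-2; y k.-1] \subset G).

Definition vertices y k : {set V} := [set y (val i) | i : 'I_k].

Definition injective_upto y k :=
  forall i j, (i < k)%N -> (j < k)%N -> y i = y j -> i = j.

Lemma subset3 a b c G : ([set a; b; c] \subset G) = [&& a \in G, b \in G & c \in G].
Proof. by rewrite !subUset !sub1set andbA. Qed.

Lemma path_familyP y k G : reflect
  (exists i, [/\ (i.+2 < k)%N, y i \in G, y i.+1 \in G & y i.+2 \in G])
  (path_family y k G).
Proof.
apply: (iffP existsP) => [[i /andP[ik]]|[i [ik y0 y1 y2]]].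
  by rewrite subset3 => /and3P[*]; exists i.
have ik' : (i < k)%N by lia.
by exists (Ordinal ik'); rewrite /= ik subset3 y0 y1.
Qed.

Lemma verticesP y k v : reflect (exists2 i, (i < k)%N & v = y i) (v \in vertices y k).
Proof.
apply: (iffP imsetP) => [[i _ ->]|[i ik ->]]; first by exists i.
by exists (Ordinal ik).
Qed.

Lemma mem_vertices y k i : (i < k)%N -> y i \in vertices y k.
Proof. by move=> ik; apply/verticesP; exists i. Qed.

Lemma vertices0 y : vertices y 0 = set0.
Proof. by apply/setP => v; rewrite inE; apply/verticesP => -[]. Qed.

Lemma verticesS y k : vertices y k.+1 = y k |: vertices y k.
Proof.
apply/setP => v; rewrite !inE; apply/verticesP/orP => [[i]|].
  rewrite ltnS leq_eqVlt => /orP[/eqP->->|ik ->]; first by left.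
  by right; apply: mem_vertices.
case=> [/eqP->|/verticesP[i ik ->]]; first by exists k.
by exists i => //; apply: ltnW.
Qed.

Lemma notin_vertices y n k i : injective_upto y n -> (i < n)%N -> (k <= i)%N ->
  y i \notin vertices y k.
Proof.
move=> yI i_n ki; apply/negP => /verticesP[j jk] /yI jE.
have : i = j by apply: jE => //; lia.
lia.
Qed.

Lemma injective_uptoW y k l : (k <= l)%N -> injective_upto y l -> injective_upto y k.
Proof. by move=> kl yI i j ik jk; apply: yI; exact: leq_trans kl. Qed.

Lemma eq_uptoE y k i j : injective_upto y k -> (i < k)%N -> (j < k)%N ->
  (y i == y j) = (i == j).
Proof. by move=> yI ik jk; apply/eqP/eqP => [/yI|->//]; apply. Qed.

Lemma path_family_outside y k G v : v \notin vertices y k ->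
  path_family y k (G :|: [set v]) = path_family y k G.
Proof.
move=> vY; have nv i : (i < k)%N -> (y i \in G :|: [set v]) = (y i \in G).
  move=> ik; rewrite !inE orbC; case: eqP => //= yE.
  by rewrite -yE mem_vertices in vY.
apply/path_familyP/path_familyP => -[i [ik]]; rewrite ?nv; try lia;
  by move=> *; exists i; rewrite ?nv; try lia.
Qed.

(** Dividing by the new window turns window [j.-1] into the variable [y j.-1]. Windows [j - 2] and
    [j - 3] contain this vertex and are absorbed; the others lie in the first [j.-1] vertices. *)
Lemma colon_path y j : injective_upto y j.+3 ->
  colon (path_family y j.+2) (window y j) =1
  fun G => (0 < j)%N && (y j.-1 \in G) || path_family y j.-1 G.
Proof.
move=> yI G; have nm i : (i < j)%N -> (y i \in G :|: window y j) = (y i \in G).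
  move=> ij; rewrite !inE !(eq_uptoE yI); lia.
rewrite /colon; apply/path_familyP/orP.
  move=> [i [ij y0 y1 y2]].
  have [E|ne1] := eqVneq j i.+1; first by left; move: y0; rewrite nm E //=.
  have [E|ne2] := eqVneq j i.+2; first by left; move: y1; rewrite nm E //=.
  have [E|ne3] := eqVneq j i.+3; first by left; move: y2; rewrite nm E //=.
  move=> *; right; apply/path_familyP; exists i.
  by rewrite -!nm; try lia; split=> //; lia.
case=> [/andP[j0 yj]|/path_familyP[i [ij y0 y1 y2]]].
  exists j.-1; rewrite (ltn_predK j0); split; rewrite ?inE ?eqxx ?orbT ?yj //; lia.
by exists i; rewrite !nm; try lia; split=> //; lia.
Qed.

(** Window [j - 2] loses [y j] and becomes the edge before it, which absorbs window [j - 3]: the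
    same kind of ideal, two vertices shorter. *)
Lemma colon_edge_path y j : injective_upto y j.+2 ->
  colon (path_family y j.+1) [set y j; y j.+1] =1 edge_path_family y j.
Proof.
move=> yI G; have nm i : (i < j)%N -> (y i \in G :|: [set y j; y j.+1]) = (y i \in G).
  move=> ij; rewrite !inE !(eq_uptoE yI); lia.
rewrite /colon /edge_path_family; apply/path_familyP/orP.
  move=> [i [ij y0 y1 y2]].
  have [E|ne1] := eqVneq j i.+2.
    by right; move: y0 y1; rewrite !nm E //= subUset !sub1set => -> ->.
  have [E|ne2] := eqVneq j i.+3.
    by right; move: y1 y2; rewrite !nm E //= subUset !sub1set => -> ->.
  left; apply/path_familyP; exists i.
  by rewrite -!nm; try lia; split=> //; lia.
case=> [/path_familyP[i [ij y0 y1 y2]]|/andP[j1]].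
  by exists i; rewrite !nm; try lia; split=> //; lia.
rewrite subUset !sub1set => /andP[y0 y1]; exists j.-2.
have -> : j.-2.+1 = j.-1 by lia.
have -> : j.-1.+1 = j by lia.
by split; rewrite ?inE ?eqxx ?orbT ?y0 ?y1 //; lia.
Qed.

Variable (K : fieldType).

(** The degree bound, and whether full multidegree occurs, for a path on [k] vertices. From [k] to
    [k + 4] the first grows by 2 and the second is unchanged, which is the recursion of the next
    induction. *)
Definition path_pd k := (2 * (k %/ 4) + (k %% 4 == 3))%N.
Definition path_full k := (k %% 4 == 0)%N || (k %% 4 == 3)%N.

Lemma path_familyE y j : path_family y j.+3 =1
  adjoin (path_family y j.+2) (window y j).
Proof.
move=> G; rewrite /adjoin; apply/path_familyP/orP.
  move=> [i [ij y0 y1 y2]]; have [<-|ne] := eqVneq i j.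
    by right; rewrite subset3 y0 y1.
  left; apply/path_familyP; exists i; split=> //; lia.
case=> [/path_familyP[i [ij *]]|]; first by exists i; split=> //; lia.
by rewrite subset3 => /and3P[*]; exists j.
Qed.

Lemma path_family_small y k : (k < 3)%N -> path_family y k =1 pred0.
Proof. by move=> k3 G; apply/path_familyP => -[i []]; lia. Qed.

Lemma concentrated_pred0 y k : (0 < k)%N ->
  concentrated K pred0 (vertices y k) 0 false.
Proof.
move=> k0; apply: concentrated_widen (concentrated0 K V) => //.
apply/properP; split; first exact: sub0set.
by exists (y 0); rewrite ?inE ?mem_vertices.
Qed.

Lemma vertices_proper y k l : (k < l)%N -> injective_upto y l ->
  vertices y k == vertices y l = false.
Proof.
move=> kl yI; apply/negbTE/eqP => E.
have := mem_vertices y kl; rewrite -E; apply/negP.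
exact: notin_vertices yI _ _.
Qed.

Lemma vertices_sub y k l : (k <= l)%N -> vertices y k \subset vertices y l.
Proof.
move=> kl; apply/subsetP => _ /verticesP[i ik ->].
by apply: mem_vertices; apply: leq_trans kl.
Qed.

(** The last window is adjoined to the path on [k - 1] vertices, which misses a vertex and so gives
    nothing of full multidegree. The colon ideal is a variable plus the path on [k - 4] vertices:
    one degree for the variable, one for the cone. *)
Lemma path_concentrated y k : injective_upto y k ->
  concentrated K (path_family y k) (vertices y k) (path_pd k) (path_full k).
Proof.
elim/ltn_ind: k y => k IH y yI; case: (ltnP k 3) => [k3|].
  apply: (@eq_concentrated _ _ pred0) => [G|]; first by rewrite path_family_small.
  case: k k3 {IH yI} => [|[|[]]] // _; try exact: concentrated_pred0.
  by rewrite vertices0; apply: concentrated0.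
case: k IH yI => [|[|[|j]]] // IH yI _.
apply: (@eq_concentrated _ _ (adjoin (path_family y j.+2) (window y j))).
  by move=> G; rewrite path_familyE.
have c1 := IH j.+2 (ltnSn _) y (injective_uptoW (leqnSn _) yI).
have dY : [disjoint vertices y j & window y j].
  apply/disjoint_notinP => _ /verticesP[i ij ->].
  rewrite !inE !(eq_uptoE yI); lia.
have eY : vertices y j :|: window y j = vertices y j.+3.
  rewrite !verticesS; apply/setP => v; rewrite !inE.
  by case: (v == y j); case: (v == y j.+1); case: (v == y j.+2); rewrite ?orbT ?orbF.
have sY : vertices y j.+2 \subset vertices y j.+3 by apply: vertices_sub.
have nY := vertices_proper (ltnSn j.+2) yI.
(* For [j = 0] there is a single window, and the colon ideal is zero on no vertices. *)
case: j => [|i] in IH yI c1 dY eY sY nY *.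
  have c2 : concentrated K (colon (path_family y 2) (window y 0)) (vertices y 0) 0 true.
    rewrite vertices0; apply: eq_concentrated (concentrated0 _ _) => G.
    by rewrite colon_path //= path_family_small.
  have := concentrated_adjoin (b := 1) c1 c2 sY eY dY isT isT.
  rewrite nY /=; apply=> //.
have c2 : concentrated K (colon (path_family y i.+3) (window y i.+1))
    (vertices y i.+1) (path_pd i).+1 (path_full i).
  rewrite verticesS.
  apply: (@eq_concentrated _ _ (adjoin (path_family y i) [set y i])).
    by move=> G; rewrite colon_path // /adjoin sub1set orbC.
  have yi : y i \notin vertices y i by apply: notin_vertices yI _ _; lia.
  apply: concentrated_var => // [G|]; first exact: path_family_outside.
  apply: IH; first lia.
  by apply: injective_uptoW yI; lia.
have -> : path_full i.+4 = path_full i by rewrite /path_full; lia.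
have := concentrated_adjoin (b := path_pd i.+4) c1 c2 sY eY dY.
rewrite nY /=; apply; rewrite /path_pd; try lia.
by move=> E; rewrite E eqxx in nY.
Qed.

(** Adjoining the last edge leaves the same problem on [k - 2] vertices as colon ideal, so two
    vertices cost one degree. *)
Lemma edge_path_concentrated y k : injective_upto y k ->
  concentrated K (edge_path_family y k) (vertices y k) k./2 (~~ odd k).
Proof.
elim/ltn_ind: k y => k IH y yI; case: k IH yI => [|[|j]] IH yI.
- rewrite vertices0; apply: eq_concentrated (concentrated0 _ _) => G.
  by rewrite /edge_path_family path_family_small.
- apply: (@eq_concentrated _ _ pred0); last exact: concentrated_pred0.
  by move=> G; rewrite /edge_path_family path_family_small.
have c1 := path_concentrated (injective_uptoW (leqnSn _) yI).
have c2 : concentrated K (colon (path_family y j.+1) [set y j; y j.+1])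
    (vertices y j) j./2 (~~ odd j).
  apply: (@eq_concentrated _ _ (edge_path_family y j)).
    by move=> G; rewrite colon_edge_path.
  apply: IH; first lia.
  by apply: injective_uptoW yI; lia.
have dY : [disjoint vertices y j & [set y j; y j.+1]].
  apply/disjoint_notinP => _ /verticesP[i ij ->].
  rewrite !inE !(eq_uptoE yI); lia.
have eY : vertices y j :|: [set y j; y j.+1] = vertices y j.+2.
  rewrite !verticesS; apply/setP => v; rewrite !inE.
  by case: (v == y j); case: (v == y j.+1); rewrite ?orbT ?orbF.
have nY := vertices_proper (ltnSn j.+1) yI.
have sY : vertices y j.+1 \subset vertices y j.+2 by apply: vertices_sub.
have := concentrated_adjoin (b := j./2.+1) c1 c2 sY eY dY.
rewrite nY /= negbK; apply=> //; rewrite /path_pd; try lia.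
by move=> E; rewrite E eqxx in nY.
Qed.

(* The path ideal of the cycle on [y 0], ..., [y n.-1]; the two extra generators are the
   windows through the edge [{y n.-1, y 0}]. *)
Definition cycle_family y n : pred {set V} :=
  adjoin (adjoin (path_family y n) [set y n.-2; y n.-1; y 0])
    [set y n.-1; y 0; y 1].

Definition cycle_pd n := (2 * (n %/ 4) + (n %% 4 != 0))%N.

(** Window [k.+1] becomes the variable [y k.+1], absorbing windows [k] and [k - 1]; window 0 becomes
    the edge of [y 1] and [y 2]. The path from [y 1] to [y k] is listed backwards to have this edge
    at its end. *)
Lemma colon_cycle1 y k : injective_upto y k.+4 ->
  colon (path_family y k.+4) [set y k.+2; y k.+3; y 0] =1
  adjoin (edge_path_family (fun i => y (k - i)%N) k) [set y k.+1].
Proof.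
move=> yI G; set m := [set _; _; _].
have nm i : (0 < i < k.+2)%N -> (y i \in G :|: m) = (y i \in G).
  move=> ij; rewrite !inE !(eq_uptoE yI); lia.
rewrite /colon /adjoin /edge_path_family sub1set; apply/path_familyP/orP.
  move=> [i [ij y0 y1 y2]].
  have [E|ne1] := eqVneq i k.+1; first by right; rewrite -nm -?E; lia.
  have [E|ne2] := eqVneq i k; first by right; rewrite -nm -?E; lia.
  have [E|ne3] := eqVneq i.+1 k; first by right; rewrite -nm -?E; lia.
  left; case: (ltnP i 2) => i2; last first.
    apply/orP; left; apply/path_familyP; exists (k - i.+2)%N.
    have -> : (k - (k - i.+2).+1 = i.+1)%N by lia.
    have -> : (k - (k - i.+2).+2 = i)%N by lia.
    have -> : (k - (k - i.+2) = i.+2)%N by lia.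
    by rewrite -!nm; try lia; split=> //; lia.
  apply/orP; right; have k2 : (1 < k)%N by lia.
  rewrite k2 subUset !sub1set /=.
  have -> : (k - k.-1 = 1)%N by lia.
  have -> : (k - k.-2 = 2)%N by lia.
  rewrite -!nm; try lia.
  by case: i {ij ne1 ne2 ne3} i2 y0 y1 y2 => [|[]] // _ y0 y1 y2; apply/andP.
case=> [/orP[/path_familyP[i [ij y0 y1 y2]]|/andP[k1]]|yk].
- exists (k - i.+2)%N.
  have -> : ((k - i.+2).+1 = k - i.+1)%N by lia.
  have -> : ((k - i.+1).+1 = k - i)%N by lia.
  by rewrite !nm; try lia; split=> //; lia.
- have -> : (k - k.-1 = 1)%N by lia.
  have -> : (k - k.-2 = 2)%N by lia.
  move: k1; rewrite /= subUset !sub1set => k1 /andP[y2 y1].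
  by exists 0%N; rewrite (nm 1%N) ?(nm 2%N) ?y1 ?y2; try lia; rewrite !inE eqxx !orbT; split.
by exists k.+1; rewrite (nm k.+1) ?yk; try lia; rewrite !inE !eqxx !orbT; split.
Qed.

(** Window 0 becomes [y 2] and the previously added generator becomes [y k.+2]. Windows avoiding
    both lie among [y 3], ..., [y k.+1]. *)
Lemma colon_cycle2 y k : injective_upto y k.+4 ->
  colon (adjoin (path_family y k.+4) [set y k.+2; y k.+3; y 0])
    [set y k.+3; y 0; y 1] =1
  adjoin (adjoin (path_family (fun i => y i.+3) k.-1) [set y 2]) [set y k.+2].
Proof.
move=> yI G; set m := [set y k.+3; _; _].
have nm i : (1 < i < k.+3)%N -> (y i \in G :|: m) = (y i \in G).
  move=> ij; rewrite !inE !(eq_uptoE yI); lia.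
rewrite /colon /adjoin !sub1set subset3 nm; last lia.
have -> : (y k.+3 \in G :|: m) && (y 0 \in G :|: m) by rewrite !inE !eqxx !orbT.
rewrite andbT; case: (boolP (y k.+2 \in G)) => yk; rewrite ?orbT // !orbF.
apply/path_familyP/orP.
  move=> [i [ij y0 y1 y2]].
  have [E|ne1] := eqVneq i k.+1; first by rewrite -nm -?E ?y1 in yk; lia.
  have [E|ne2] := eqVneq i k; first by rewrite -nm -?E ?y2 in yk; lia.
  case: (ltnP i 3) => i3.
    right; rewrite -nm; last lia.
    by case: i i3 {ij ne1 ne2} y0 y1 y2 => [|[|[]]].
  left; apply/path_familyP; exists (i - 3)%N.
  have -> : ((i - 3).+3 = i)%N by lia.
  by rewrite -!nm; try lia; split=> //; lia.
case=> [/path_familyP[i [ij y0 y1 y2]]|y2].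
  by exists i.+3; rewrite !nm; try lia; split=> //; lia.
by exists 0%N; rewrite (nm 2%N) ?y2; try lia; rewrite !inE !eqxx !orbT; split.
Qed.

(** Full multidegree comes from the path if n is 0 or 3 mod 4, from the first colon ideal if n is
    even, and from the second if n is 0 or 1 mod 4. Every residue is covered, and each source lands
    in degree [cycle_pd n]. *)
Lemma cycle_concentrated y n : (3 < n)%N -> injective_upto y n ->
  concentrated K (cycle_family y n) (vertices y n) (cycle_pd n) true.
Proof.
case: n => [|[|[|[|k]]]] // _ yI.
have c0 := path_concentrated yI.
have c1 : concentrated K (colon (path_family y k.+4) [set y k.+2; y k.+3; y 0])
    (y k.+1 |: vertices (fun i => y (k - i)%N) k) k./2.+1 (~~ odd k).
  apply: (@eq_concentrated _ _
    (adjoin (edge_path_family (fun i => y (k - i)%N) k) [set y k.+1])).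
    by move=> G; rewrite colon_cycle1.
  have nyk l : (l <= k)%N -> y k.+1 \notin vertices (fun i => y (k - i)%N) l.
    move=> lk; apply/negP => /verticesP[i ik] /yI; lia.
  apply: concentrated_var; first exact: nyk.
    move=> G; rewrite /edge_path_family path_family_outside ?nyk ?leq_pred //.
    case: (ltnP 1 k) => //= k1; rewrite !subUset !sub1set !inE.
    by rewrite !(eq_uptoE yI); try lia; congr (_ || (_ && _)); lia.
  apply: edge_path_concentrated => i j ik jk /yI E.
  have : (k - i = k - j)%N by apply: E; lia.
  lia.
have memY i : (i < k.+4)%N -> y i \in vertices y k.+4 by apply: mem_vertices.
have d1 : [disjoint y k.+1 |: vertices (fun i => y (k - i)%N) k &
    [set y k.+2; y k.+3; y 0]].
  apply/disjoint_notinP => v; rewrite inE => /orP[/set1P->|/verticesP[i ik ->]];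
    rewrite !inE !(eq_uptoE yI); lia.
have e1 : (y k.+1 |: vertices (fun i => y (k - i)%N) k) :|: [set y k.+2; y k.+3; y 0]
    = vertices y k.+4.
  apply/setP => v; apply/idP/idP.
    rewrite !inE => /orP[/orP[/eqP->|/verticesP[i ik ->]]|/orP[/orP[]|] /eqP->];
      by apply: memY; lia.
  move=> /verticesP[i ik ->]; rewrite !inE !(eq_uptoE yI); try lia.
  have [?|?] := boolP [|| i == 0%N, i == k.+1, i == k.+2 | i == k.+3]; first lia.
  apply/orP; left; apply/orP; right; apply/verticesP; exists (k - i)%N; first lia.
  by congr y; lia.
have c01 : concentrated K
    (adjoin (path_family y k.+4) [set y k.+2; y k.+3; y 0]) (vertices y k.+4)
    (cycle_pd k.+4) (path_full k.+4 || ~~ odd k).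
  have := concentrated_adjoin (b := cycle_pd k.+4) c0 c1 (subxx _) e1 d1.
  rewrite eqxx /=; apply; rewrite /cycle_pd /path_pd /path_full; lia.
(* For [k = 0] the variables [y 2] and [y k.+2] coincide and count only once. *)
pose Y2 := y k.+2 |: (if k == 0%N then set0 else y 2 |: vertices (fun i => y i.+3) k.-1).
have c2 : concentrated K
    (colon (adjoin (path_family y k.+4) [set y k.+2; y k.+3; y 0]) [set y k.+3; y 0; y 1])
    Y2 (if k == 0%N then 1 else (path_pd k.-1).+2)%N ((k == 0%N) || path_full k.-1).
  apply: (@eq_concentrated _ _
     (adjoin (adjoin (path_family (fun i => y i.+3) k.-1) [set y 2]) [set y k.+2])).
    by move=> G; rewrite colon_cycle2.
  rewrite /Y2; case: (posnP k) => [->|k0] /=.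
    apply: (@eq_concentrated _ _ (adjoin pred0 [set y 2])).
      by move=> G; rewrite /adjoin path_family_small //= orbb.
    apply: concentrated_var; rewrite ?inE //.
    exact: concentrated0.
  have n2 : y 2 \notin vertices (fun i => y i.+3) k.-1.
    apply/negP => /verticesP[i ik] /yI; lia.
  have nk : y k.+2 \notin vertices (fun i => y i.+3) k.-1.
    apply/negP => /verticesP[i ik] /yI; lia.
  apply: concentrated_var.
  - by rewrite !inE negb_or nk (eq_uptoE yI) //; lia.
  - move=> G; rewrite /adjoin path_family_outside // !sub1set !inE (eq_uptoE yI) //.
    by congr (_ || _); lia.
  apply: concentrated_var => // [G|]; first by rewrite path_family_outside.
  apply: path_concentrated => i j ik jk /yI E.
  have : (i.+3 = j.+3)%N by apply: E; lia.
  lia.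
have d2 : [disjoint Y2 & [set y k.+3; y 0; y 1]].
  apply/disjoint_notinP => v; rewrite inE => /orP[/set1P->|].
    by rewrite !inE !(eq_uptoE yI); lia.
  case: ifP => [_|/eqP k0]; first by rewrite inE.
  by rewrite inE => /orP[/set1P->|/verticesP[i ik ->]];
    rewrite !inE !(eq_uptoE yI); lia.
have e2 : Y2 :|: [set y k.+3; y 0; y 1] = vertices y k.+4.
  apply/setP => v; apply/idP/idP.
    rewrite !inE => /orP[/orP[/eqP->|]|/orP[/orP[]|] /eqP->]; try by apply: memY; lia.
    case: ifP => [_|/eqP k0]; first by rewrite inE.
    by rewrite !inE => /orP[/eqP->|/verticesP[i ik ->]]; apply: memY; lia.
  move=> /verticesP[i ik ->]; rewrite !inE !(eq_uptoE yI); try lia.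
  have [?|?] := boolP [|| i == 0%N, i == 1%N, i == k.+2 | i == k.+3]; first lia.
  have k0 : (k == 0%N) = false by lia.
  rewrite k0 !inE (eq_uptoE yI); try lia.
  have [|i2] := eqVneq i 2; first by rewrite orbT.
  apply/orP; left; apply/orP; right; apply/verticesP; exists (i - 3)%N; first lia.
  by congr y; lia.
have := concentrated_adjoin (b := cycle_pd k.+4) c01 c2 (subxx _) e2 d2.
have -> : (vertices y k.+4 == vertices y k.+4) && (path_full k.+4 || ~~ odd k)
   || ((k == 0%N) || path_full k.-1) = true.
  rewrite eqxx /path_full; lia.
apply; rewrite ?/cycle_pd ?/path_pd ?/path_full; have [->|] := eqVneq k 0%N; lia.
Qed.

End Path.

(** * Minimal resolutions *)

Section Prune.
Variables (K : fieldType) (V : finType) (I : pred {set V}).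
Variables (X : finType) (h : X -> nat) (al : X -> {set V}) (x0 : X).
Hypothesis I0 : ~~ I set0.

Section Cancel.
Variables (A : {set X}) (c : X -> X -> K) (a b : X).
Hypothesis F : set_resolution I A h al c x0.
Hypotheses (cab : c a b != 0) (alab : al a = al b).

(* Gaussian elimination of the unit entry [c a b]: row [a] and column [b] of [e] vanish. *)
Let e x y := c x y - c x b / c a b * c a y.
Let c' x y := if [|| x == a, x == b, y == a | y == b] then 0 else e x y.

Lemma cancel_unit : set_resolution I (A :\ a :\ b) h al c' x0.
Proof.
have [Aa Ab hab _] := sr_supp F cab.
have c0 x y : h x != (h y).+1 -> c x y = 0.
  by apply: contraNeq => /(sr_supp F)[_ _ ->].
have caa : c a a = 0 by apply: c0; lia.
have cbb : c b b = 0 by apply: c0; lia.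
have cba : c b a = 0 by apply: c0; lia.
have hx0 : h x0 = 0%N by apply/eqP; rewrite (sr_h0 F) ?(sr_x0 F).
have a0 : x0 != a by apply/eqP => E; move: hab; rewrite -E hx0.
(* The generator is never cancelled: a unit entry in its column would put the empty set in [I],
   making the ideal the whole ring. *)
have b0 : x0 != b.
  apply: contraNneq I0 => E; rewrite -(sr_al0 F) E -alab; apply: (sr_aug F).
  by rewrite E.
have ea y : e a y = 0 by rewrite /e divff // mul1r subrr.
have eb x : e x b = 0 by rewrite /e divfK // subrr.
have e_supp x y : e x y != 0 ->
    c x y != 0 \/ c x b != 0 /\ c a y != 0.
  move=> exy; case: (eqVneq (c x y) 0) => cxy; [right|by left].
  by move: exy; rewrite /e cxy sub0r oppr_eq0 !mulf_eq0 !negb_or => /andP[/andP[-> _] ->].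
have c'E x y : c' x y != 0 -> [/\ x != a, x != b, y != a, y != b & e x y != 0].
  rewrite /c'; case: ifP => [_|/negbT]; first by rewrite eqxx.
  by rewrite !negb_or => /and4P[].
split.
- exact: sr_mono F.
- move=> x y /c'E[xa xb ya yb /e_supp]; rewrite !inE xa xb ya yb /=.
  case=> [/(sr_supp F) //|[/(sr_supp F)[Ax _ hx sx] /(sr_supp F)[_ Ay hy sy]]].
  split=> //; first by rewrite hx -hab hy.
  by apply: subset_trans sy _; rewrite alab.
- by rewrite !inE a0 b0 (sr_x0 F).
- exact: sr_al0 F.
- move=> x; rewrite !inE => /and3P[_ _]. apply: (sr_h0 F).
- move=> x z.
  have ee : \sum_y e x y * e y z = 0.
    have -> : \sum_y e x y * e y z = \sum_y c x y * c y z
        - c x b / c a b * (\sum_y c a y * c y z)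
        - (\sum_y c x y * c y b) * (c a z / c a b)
        + c x b / c a b * (\sum_y c a y * c y b) * (c a z / c a b).
      rewrite !mulr_sumr !mulr_suml -!sumrB -big_split /=.
      by apply: eq_bigr => y _; rewrite /e; ring.
    by rewrite !(sr_cc F) !mulr0 !mul0r !subr0 addr0.
  case: (boolP [|| x == a, x == b, z == a | z == b]) => E.
    rewrite big1 // => y _; rewrite /c'; case/or4P: E => ->;
      by rewrite ?orbT ?mul0r ?mulr0.
  rewrite -[RHS]ee; apply: eq_bigr => y _; rewrite /c'.
  move: E; rewrite !negb_or => /and4P[/negPf-> /negPf-> /negPf-> /negPf->] /=.
  rewrite !orbF; case: eqP => [->|_] /=; first by rewrite ea mul0r mulr0.
  by case: eqP => [->|_] //=; rewrite eb !mul0r.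
- move=> x /c'E[_ _ _ _ /e_supp[/(sr_aug F) //|[cxb /(sr_aug F)]]].
  by rewrite alab; apply: (sr_mono F); have [] := sr_supp F cxb.
move=> G u su uc u0.
have ua : u a = 0.
  by apply: contraTeq isT => /su; rewrite !inE eqxx andbF.
have ub : u b = 0.
  by apply: contraTeq isT => /su; rewrite !inE eqxx.
have sA x : u x != 0 -> (x \in A) && (al x \subset G).
  by move=> /su; rewrite !inE => /andP[/and3P[_ _ ->]].
(* Adding [- t] times [a] to [u] removes the coefficient at [b] from its boundary, which becomes the
   boundary of [u] under [e]. *)
pose t := (\sum_x u x * c x b) / c a b.
pose w x := if x == a then - t else u x.
have wc z : \sum_x w x * c x z = \sum_x u x * e x z.
  rewrite (bigD1 a) //= /w eqxx [RHS](bigD1 a) //= ua mul0r add0r.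
  rewrite [X in _ + X = _](_ : _ = \sum_(x | x != a) u x * c x z); last first.
    by apply: eq_bigr => x /negPf->.
  rewrite /t (bigD1 a) //= ua mul0r add0r /e.
  rewrite mulr_suml mulNr mulr_suml -sumrN -big_split /=.
  by apply: eq_bigr => x _; ring.
have wc0 z : z != a -> \sum_x w x * c x z = 0.
  move=> za; rewrite wc; case: (eqVneq z b) => [->|zb].
    by rewrite big1 // => x _; rewrite eb mulr0.
  rewrite -[RHS](uc z); apply: eq_bigr => x _; rewrite /c' (negPf za) (negPf zb).
  case: eqVneq => [->|_] /=; first by rewrite ua !mul0r.
  by case: eqVneq => [->|_] //=; rewrite ub !mul0r.
(* The boundary of [w] is supported at [a] alone; applying the differential again and reading at
   [b], where [c a b] is invertible, shows that it vanishes. *)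
have wca : \sum_x w x * c x a = 0.
  have E : \sum_y (\sum_x w x * c x y) * c y b = 0.
    under eq_bigr do rewrite mulr_suml.
    rewrite exchange_big big1 //= => x _; under eq_bigr do rewrite -mulrA.
    by rewrite -mulr_sumr (sr_cc F) mulr0.
  move: E; rewrite (bigD1 a) //= [X in _ + X]big1 ?addr0; last first.
    by move=> z za; rewrite wc0 // mul0r.
  by move/eqP; rewrite mulf_eq0 (negPf cab) orbF => /eqP.
have [|||v sv vE] := @sr_exact _ _ _ _ _ _ _ _ _ F G w.
- move=> x; rewrite /w; case: ifP => [/eqP->|_]; last exact: sA.
  rewrite oppr_eq0 mulf_eq0 negb_or => /andP[/sum_neq0[y]].
  rewrite mulf_eq0 negb_or => /andP[/sA /andP[_ yG] /(sr_supp F)[_ _ _ sy]] _.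
  by rewrite Aa alab (subset_trans sy yG).
- by move=> z; case: (eqVneq z a) => [->//|]; apply: wc0.
- by rewrite /w (negPf a0).
(* Subtracting a multiple of the boundary of [a] clears the coefficient at [b] and keeps the
   boundary. The coefficient at [a] can then be dropped, row [a] of [e] being zero. *)
pose v1 x := v x - v b / c a b * c a x.
have v1b : v1 b = 0 by rewrite /v1 divfK // subrr.
have v1E z : \sum_x v1 x * c x z = w z.
  rewrite vE; transitivity (\sum_x v x * c x z - v b / c a b * \sum_x c a x * c x z).
    rewrite mulr_sumr -sumrB; apply: eq_bigr => x _; rewrite /v1; ring.
  by rewrite (sr_cc F) mulr0 subr0.
exists (fun x => if x == a then 0 else v1 x).
  move=> x /=; case: ifP => [|/negbT xa v1x]; first by rewrite eqxx.
  have xb : x != b by apply: contraNneq v1x => ->; rewrite v1b.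
  rewrite !inE xa xb /=.
  case: (eqVneq (v x) 0) => [vx|/sv //].
  move: v1x; rewrite /v1 vx sub0r oppr_eq0 !mulf_eq0 !negb_or.
  move=> /andP[/andP[/sv /andP[_ bG] _] /(sr_supp F)[_ -> _ sx]] /=.
  by apply: subset_trans sx _; rewrite alab.
move=> z; case: (eqVneq z a) => [->|za].
  by rewrite ua big1 // => x _; rewrite /c' eqxx !orbT mulr0.
case: (eqVneq z b) => [->|zb].
  by rewrite ub big1 // => x _; rewrite /c' eqxx !orbT mulr0.
transitivity (\sum_x v1 x * e x z).
  transitivity (w z); first by rewrite /w (negPf za).
  have wb : w b = 0 by rewrite /w; case: eqP => [E|//]; move: hab; rewrite E; lia.
  transitivity (w z - w b / c a b * c a z); first by rewrite wb !mul0r subr0.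
  rewrite -!v1E !mulr_suml -sumrB; apply: eq_bigr => x _; rewrite /e; ring.
apply: eq_bigr => x _; rewrite /c' (negPf za) (negPf zb) !orbF.
case: (eqVneq x a) => [->|_] /=; first by rewrite ea mulr0 mul0r.
by case: eqVneq => [->|_] //=; rewrite v1b !mul0r.
Qed.

End Cancel.

(** Each cancellation removes two elements of equal multidegree in consecutive homological degrees.
    All elements sharing the multidegree of [t] have its homological degree, so [t] is never one of
    them. *)
Lemma prune (A : {set X}) (c : X -> X -> K) t : set_resolution I A h al c x0 -> t \in A ->
  (forall x, x \in A -> al x = al t -> h x = h t) ->
  exists (A' : {set X}) (c' : X -> X -> K), [/\ set_resolution I A' h al c' x0, A' \subset A,
    t \in A' & forall x y, c' x y != 0 -> al x != al y].
Proof.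
have [k] := ubnP #|A|; elim: k A c => // k IH A c; rewrite ltnS => Ak F At tA.
case: (boolP [exists a, exists b, (c a b != 0) && (al a == al b)]); last first.
  move=> /existsPn nE; exists A, c; split=> // x y cxy.
  by have /existsPn/(_ y) := nE x; rewrite cxy.
move=> /existsP[a /existsP[b /andP[cab /eqP alab]]].
have [Aa Ab hab _] := sr_supp F cab.
have ta : t != a.
  by apply/eqP => E; have := tA b Ab; rewrite -alab E => /(_ erefl); lia.
have tb : t != b.
  by apply/eqP => E; have := tA a Aa; rewrite alab E => /(_ erefl); lia.
have sA : A :\ a :\ b \subset A by apply/subsetP => x; rewrite !inE => /and3P[].
have cA : (#|A :\ a :\ b| < k)%N.
  apply: leq_trans Ak; apply: proper_card; apply/properP; split=> //.
  by exists a; rewrite // !inE eqxx /= andbF.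
have [||A' [c' [F' A'A tA' min]]] := IH _ _ cA (cancel_unit F cab alab).
- by rewrite !inE ta tb.
- by move=> x Ax; apply: tA; apply: (subsetP sA).
by exists A', c'; split=> //; apply: subset_trans sA.
Qed.

End Prune.

(** * Squarefree monomials and ideals over the polynomial ring *)

Section Monomials.
Variables (K : fieldType) (V : finType).
Implicit Types (S T : {set V}) (k : 'X_{1..#|V|}).

Definition squarefree_mnm S : 'X_{1..#|V|} :=
  [multinom nat_of_bool (enum_val i \in S) | i < #|V|].

Definition mnm_support k : {set V} := [set z | (0 < k (enum_rank z))%N].

Lemma squarefree_le S k : (squarefree_mnm S <= k)%MM = (S \subset mnm_support k).
Proof.
apply/mnm_lepP/subsetP => [Sk z zS|Sk i].
  by rewrite inE; apply: leq_trans (Sk _); rewrite mnmE enum_rankK zS.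
rewrite mnmE; case: (boolP (_ \in S)) => // /Sk.
by rewrite inE enum_valK.
Qed.

Lemma squarefree_support S : mnm_support (squarefree_mnm S) = S.
Proof. by apply/setP => z; rewrite inE mnmE enum_rankK lt0b. Qed.

Lemma squarefree_leE S T : (squarefree_mnm S <= squarefree_mnm T)%MM = (S \subset T).
Proof. by rewrite squarefree_le squarefree_support. Qed.

Lemma squarefree0 : squarefree_mnm set0 = 0%MM.
Proof. by apply/mnmP => i; rewrite mnmE mnm0E inE. Qed.

Lemma mdeg_squarefree S : mdeg (squarefree_mnm S) = #|S|.
Proof.
rewrite mdegE (reindex (@enum_rank V)) /=; last first.
  by exists enum_val => i _; rewrite ?enum_rankK ?enum_valK.
rewrite -[RHS]sum1_card [RHS]big_mkcond /=; apply: eq_bigr => z _.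
by rewrite mnmE enum_rankK; case: (z \in S).
Qed.

Lemma mnm_supportS k l : (k <= l)%MM -> mnm_support k \subset mnm_support l.
Proof.
by move=> /mnm_lepP kl; apply/subsetP => z; rewrite !inE => /leq_trans; apply.
Qed.

Lemma mcoeffMX_if (p : {mpoly K[#|V|]}) m k :
  (p * 'X_[m])@_k = if (m <= k)%MM then p@_(k - m) else 0.
Proof.
case: ifPn => [mk|nmk]; first by rewrite -{1}(submK mk) addmC mcoeffMX.
apply: memN_msupp_eq0; rewrite (perm_mem (msuppMX p m)).
by apply: contra nmk => /mapP[l _ ->]; apply: lem_addr.
Qed.

Variable I : pred {set V}.
Hypothesis I_mono : forall S T, S \subset T -> I S -> I T.

Definition family_ideal (f : {mpoly K[#|V|]}) : Prop :=
  forall k, k \in msupp f -> I (mnm_support k).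

Lemma family_ideal0 : family_ideal 0.
Proof. by move=> k; rewrite msupp0. Qed.

Lemma family_idealD f g : family_ideal f -> family_ideal g -> family_ideal (f + g).
Proof. by move=> If Ig k /msuppD_le; rewrite mem_cat => /orP[/If|/Ig]. Qed.

Lemma family_idealM f g : family_ideal g -> family_ideal (f * g).
Proof.
move=> Ig k /msuppM_le /allpairsP[[k1 k2] /= [_ /Ig Ik ->]].
apply: I_mono Ik; apply: mnm_supportS; exact: lem_addl.
Qed.

Lemma family_ideal_sum (T : Type) (r : seq T) (P : pred T) F :
  (forall x, P x -> family_ideal (F x)) -> family_ideal (\sum_(x <- r | P x) F x).
Proof.
by move=> IF; elim/big_ind: _ => //; [exact: family_ideal0|exact: family_idealD].
Qed.

End Monomials.

(** Conversely to the easy inclusion, each monomial of [f] is assigned by [pick] to one generator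
    dividing it, and the quotients are collected generator by generator. *)
Lemma closed_nbhd_idealE (K : fieldType) (V : finType) (e : rel V) f :
  closed_nbhd_ideal K e f <->
  family_ideal (fun G => [exists w, closed_nbhd e w \subset G]) f.
Proof.
have I_mono (S T : {set V}) : S \subset T -> [exists w, closed_nbhd e w \subset S] ->
    [exists w, closed_nbhd e w \subset T].
  move=> ST /existsP[w wS]; apply/existsP; exists w; exact: subset_trans ST.
have mE w : nbhd_monomial K e w = 'X_[squarefree_mnm (closed_nbhd e w)].
  rewrite /nbhd_monomial /vertex_var mpolyXE_id.
  rewrite [RHS](reindex (@enum_rank V)) /=; last first.
    by exists enum_val => i _; rewrite ?enum_rankK ?enum_valK.
  rewrite big_mkcond; apply: eq_bigr => z _.
  by rewrite mnmE enum_rankK; case: ifP; rewrite ?expr0 ?expr1.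
split=> [[c ->]|If].
  apply: family_ideal_sum => w _; apply: family_idealM => // k.
  rewrite mE msuppX inE => /eqP->; rewrite squarefree_support.
  by apply/existsP; exists w.
pose t k := [pick w | closed_nbhd e w \subset mnm_support k].
exists (fun w => \sum_(k <- msupp f | t k == Some w)
  f@_k *: 'X_[k - squarefree_mnm (closed_nbhd e w)]).
under eq_bigr => w _ do rewrite mE mulr_suml.
rewrite (exchange_big_dep xpredT) //= [LHS]mpolyE big_seq [RHS]big_seq.
apply: eq_bigr => k /If /existsP[w0 w0k].
rewrite /t; case: pickP => [w wk|/(_ w0)]; last by rewrite w0k.
rewrite (big_pred1 w) => [|w']; last by rewrite eq_sym.
by rewrite -scalerAl -mpolyXD submK // squarefree_le.
Qed.

(** * From scalar matrices to a minimal graded free resolution *)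

Section Homogenize.
Variables (K : fieldType) (V : finType) (I : pred {set V}).
Variables (X : finType) (A : {set X}) (h : X -> nat) (al : X -> {set V}).
Variables (c : X -> X -> K) (x0 : X).
Hypothesis F : set_resolution I A h al c x0.
Local Notation R := {mpoly K[#|V|]}.
Local Notation mu x := (squarefree_mnm (al x)).

Definition homog_diff x y : R := c x y *: 'X_[mu x - mu y].
Local Notation D := homog_diff.

Lemma homog_diff_eq0 x y : D x y != 0 ->
  [/\ x \in A, y \in A, h x = (h y).+1 & al y \subset al x].
Proof.
move=> nz; apply: (sr_supp F); apply: contraNneq nz => cxy.
by rewrite /D cxy scale0r.
Qed.

Lemma homog_diff_diff x z : \sum_y D x y * D y z = 0.
Proof.
transitivity (\sum_y (c x y * c y z) *: 'X_[mu x - mu z] : R).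
  apply: eq_bigr => y _; rewrite /D.
  case: (eqVneq (c x y) 0) => [->|/(sr_supp F)[_ _ _ sx]].
    by rewrite mul0r !scale0r mul0r.
  case: (eqVneq (c y z) 0) => [->|/(sr_supp F)[_ _ _ sy]].
    by rewrite mulr0 !scale0r mulr0.
  rewrite -scalerAl -scalerAr scalerA -mpolyXD; congr (_ *: 'X_[_]).
  apply/mnmP => i; rewrite mnmDE !mnmBE.
  have : (mu z <= mu y)%MM by rewrite squarefree_leE.
  have : (mu y <= mu x)%MM by rewrite squarefree_leE.
  move=> /mnm_lepP/(_ i) ? /mnm_lepP/(_ i) ?; lia.
by rewrite -scaler_suml (sr_cc F) scale0r.
Qed.

Lemma homog_diff_aug x : family_ideal I (D x x0).
Proof.
move=> k; case: (eqVneq (c x x0) 0) => [c0|nz]; first by rewrite /D c0 scale0r msupp0.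
rewrite msuppMCX // inE => /eqP->.
by rewrite (sr_al0 F) squarefree0 subm0 squarefree_support (sr_aug F).
Qed.

(* The multidegree-[k] component of a vector over [R]. *)
Definition component (U : X -> R) k x : K :=
  if (mu x <= k)%MM then (U x)@_(k - mu x) else 0.

(** This is the cycle equation at [z] read at the monomial [k - mu z]; if [mu z] does not divide
    [k], every term is zero. *)
Lemma component_diff U k z : (forall z, \sum_x U x * D x z = 0) ->
  \sum_x component U k x * c x z = 0.
Proof.
move=> UD; case: (boolP (mu z <= k)%MM) => [zk|nzk]; last first.
  apply: big1 => x _; rewrite /component; case: ifP => xk; last by rewrite mul0r.
  case: (eqVneq (c x z) 0) => [->|/(sr_supp F)[_ _ _ sx]]; first by rewrite mulr0.
  by rewrite !squarefree_le in nzk xk *; rewrite (subset_trans sx xk) in nzk.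
have := congr1 (mcoeff (k - mu z)%MM) (UD z); rewrite mcoeff0 raddf_sum /= => E.
rewrite -[RHS]E; apply: eq_bigr => x _; rewrite /D -scalerAr mcoeffZ mulrC.
case: (eqVneq (c x z) 0) => [->|/(sr_supp F)[_ _ _ sx]]; first by rewrite !mul0r.
congr (_ * _); rewrite mcoeffMX_if /component.
have /mnm_lepP zx : (mu z <= mu x)%MM by rewrite squarefree_leE.
move/mnm_lepP: zk => zk.
have -> : (mu x - mu z <= k - mu z)%MM = (mu x <= k)%MM.
  apply/mnm_lepP/mnm_lepP => H i; have := H i; have := zx i; have := zk i;
    rewrite ?mnmBE; lia.
case: ifP => // /mnm_lepP xk; congr (_@_ _); apply/mnmP => i.
have := zx i; have := zk i; have := xk i; rewrite !mnmBE; lia.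
Qed.

(** As [mu x] divides [k] exactly when [al x] lies in the support of [k], the strand in multidegree
    [k] is the squarefree strand of that support. The components of [U] in the finitely many
    multidegrees of [L] are lifted separately and reassembled. *)
Lemma homog_exact (U : X -> R) : (forall x, x \notin A -> U x = 0) ->
  (forall z, \sum_x U x * D x z = 0) -> family_ideal I (U x0) ->
  exists W, forall z, U z = \sum_x W x * D x z.
Proof.
move=> UA UD U0.
pose L := undup (flatten [seq [seq (mu x + k)%MM | k <- msupp (U x)] | x : X]).
have memL x k : (U x)@_k != 0 -> (mu x + k)%MM \in L.
  rewrite -mcoeff_msupp => kU; rewrite mem_undup; apply/flattenP.
  exists [seq (mu x + k)%MM | k <- msupp (U x)]; last exact: map_f.
  by apply/imageP; exists x.
have compo (i : 'I_(size L)) : exists w : X -> K,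
    supported A al (mnm_support (tnth (in_tuple L) i)) w /\
    forall z, component U (tnth (in_tuple L) i) z = \sum_x w x * c x z.
  set k := tnth _ i.
  have [|||w sw wE] := @sr_exact _ _ _ _ _ _ _ _ _ F (mnm_support k) (component U k).
  - move=> x; rewrite /component; case: ifP => [|_]; last by rewrite eqxx.
    rewrite squarefree_le => -> nz; rewrite andbT.
    by apply: contraNT nz => /UA->; rewrite mcoeff0.
  - by move=> z; apply: component_diff.
  - rewrite /component (sr_al0 F) squarefree0; case: ifP => [_|_]; last by rewrite eqxx.
    by rewrite subm0 -mcoeff_msupp => /U0.
  by exists w.
have [v vP] := fin_all_exists compo.
exists (fun x => \sum_i v i x *: 'X_[tnth (in_tuple L) i - mu x]) => z.
transitivity (\sum_i component U (tnth (in_tuple L) i) z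
    *: 'X_[tnth (in_tuple L) i - mu z] : R); last first.
  under [RHS]eq_bigr do rewrite mulr_suml.
  rewrite exchange_big; apply: eq_bigr => i _.
  have [sv ->] := vP i; rewrite scaler_suml; apply: eq_bigr => x _.
  case: (eqVneq (v i x) 0) => [->|/sv /andP[_ xk]]; first by rewrite mul0r !scale0r mul0r.
  rewrite /D -scalerAl -scalerAr scalerA -mpolyXD.
  case: (eqVneq (c x z) 0) => [->|/(sr_supp F)[_ _ _ sx]]; first by rewrite mulr0 !scale0r.
  congr (_ *: 'X_[_]); apply/mnmP => j; rewrite mnmDE !mnmBE.
  have /mnm_lepP/(_ j) : (mu z <= mu x)%MM by rewrite squarefree_leE.
  have /mnm_lepP/(_ j) : (mu x <= tnth (in_tuple L) i)%MM by rewrite squarefree_le.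
  lia.
transitivity (\sum_(k <- L) component U k z *: 'X_[k - mu z] : R); last by rewrite big_tnth.
apply/mpolyP => k; rewrite raddf_sum /=.
have E l : l != (mu z + k)%MM -> (component U l z *: 'X_[l - mu z] : R)@_k = 0.
  move=> lk; rewrite mcoeffZ mcoeffX /component; case: ifP => zl; last by rewrite mul0r.
  case: eqP => [E|]; last by rewrite mulr0.
  by move: lk; rewrite -E addmC submK ?eqxx.
case: (boolP ((mu z + k)%MM \in L)) => kL.
  rewrite (bigD1_seq _ kL) ?undup_uniq //= big1 ?addr0 => [|l]; last exact: E.
  by rewrite mcoeffZ mcoeffX addmC addmK eqxx mulr1 /component lem_addl addmK.
rewrite big_seq big1 => [|l lL]; last by apply: E; apply: contraNneq kL => <-.
by apply/eqP; apply: contraNT kL => /memL.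
Qed.

Variable Id : R -> Prop.
Hypothesis IdE : forall f, Id f <-> family_ideal I f.
Hypothesis min : forall x y, c x y != 0 -> al x != al y.

Definition basis_in i := [set x in A | h x == i].
Local Notation B := basis_in.

Definition extend_row i (u : 'rV[R]_#|B i|) x : R :=
  \sum_(a | enum_val a == x) u 0 a.

Lemma extend_row_val i (u : 'rV_#|B i|) a : extend_row u (enum_val a) = u 0 a.
Proof. by rewrite /extend_row (big_pred1 a) // => b; rewrite (inj_eq enum_val_inj). Qed.

Lemma extend_row_out i (u : 'rV_#|B i|) x : x \notin B i -> extend_row u x = 0.
Proof.
by move=> nx; apply: big_pred0 => a; apply: contraNF nx => /eqP<-; apply: enum_valP.
Qed.

Lemma extend_row_diff i (u : 'rV_#|B i|) z :
  \sum_x extend_row u x * D x z = \sum_a u 0 a * D (enum_val a) z.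
Proof.
under eq_bigr do rewrite mulr_suml.
rewrite (exchange_big_dep xpredT) //=; apply: eq_bigr => a _.
by rewrite (big_pred1 (enum_val a)) // => x; rewrite eq_sym.
Qed.

Lemma sum_basis_left i (W : X -> R) z : z \in B i ->
  \sum_x W x * D x z = \sum_(a < #|B i.+1|) W (enum_val a) * D (enum_val a) z.
Proof.
rewrite inE => /andP[_ /eqP hz].
rewrite -(big_enum_val (fun x => W x * D x z)) /=.
rewrite [RHS]big_mkcond; apply: eq_bigr => x _; case: ifPn => // nx.
case: (eqVneq (D x z) 0) => [->|/homog_diff_eq0[Ax _ hx _]]; first by rewrite mulr0.
by move: nx; rewrite inE Ax hx hz eqxx.
Qed.

Lemma sum_basis_right i (W : X -> R) x : x \in B i.+1 ->
  \sum_z D x z * W z = \sum_(a < #|B i|) D x (enum_val a) * W (enum_val a).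
Proof.
rewrite inE => /andP[_ /eqP hx].
rewrite -(big_enum_val (fun z => D x z * W z)) /=.
rewrite [RHS]big_mkcond; apply: eq_bigr => z _; case: ifPn => // nz.
case: (eqVneq (D x z) 0) => [->|/homog_diff_eq0[_ Az hz _]]; first by rewrite mul0r.
by move: nz hz; rewrite inE Az hx => nz [E]; rewrite E eqxx in nz.
Qed.

Let d i : 'M[R]_(#|B i.+1|, #|B i|) := \matrix_(a, b) D (enum_val a) (enum_val b).

Lemma in_basis0 x : (x \in B 0) = (x == x0).
Proof.
rewrite inE; case: (boolP (x \in A)) => [/(sr_h0 F)->//|nx].
by apply/esym; apply: contraNF nx => /eqP->; apply: sr_x0 F.
Qed.

Lemma basis0_val (a : 'I_#|B 0|) : enum_val a = x0.
Proof. by apply/eqP; rewrite -in_basis0 enum_valP. Qed.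

Lemma sum_basis0 (f : R) : \sum_(a < #|B 0|) f = f.
Proof.
rewrite sumr_const card_ord; have -> : B 0 = [set x0].
  by apply/setP => x; rewrite in_basis0 inE.
by rewrite cards1 mulr1n.
Qed.

(** The basis element [x] has degree [#|al x|]. Nonzero entries join distinct multidegrees by [min],
    so their monomials are nonconstant and the resolution is minimal. *)
Lemma exists_mfr : exists H : minimal_free_resolution Id,
  forall i, mfr_rank H i = #|B i|.
Proof.
have vald i (v : 'rV_#|B i.+1|) b : (v *m d i) 0 b
    = \sum_a v 0 a * D (enum_val a) (enum_val b).
  by rewrite mxE; apply: eq_bigr => a _; rewrite mxE.
have dd i : d i.+1 *m d i = 0.
  apply/matrixP => a b; rewrite [LHS]mxE [RHS]mxE.
  rewrite -[RHS](homog_diff_diff (enum_val a) (enum_val b)).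
  by rewrite (sum_basis_right _ (enum_valP a)); apply: eq_bigr => y _; rewrite !mxE.
have augE (u : 'rV_#|B 0|) : (u *m (const_mx 1 : 'cV[R]_#|B 0|)) 0 0 = \sum_a u 0 a.
  by rewrite mxE; apply: eq_bigr => a _; rewrite mxE mulr1.
have homogP i (a : 'I_#|B i.+1|) (b : 'I_#|B i|) m : m \in msupp (d i a b) ->
    (mdeg m)%:Z + #|al (enum_val b)|%:Z = #|al (enum_val a)|%:Z.
  rewrite mxE /D; case: (eqVneq (c (enum_val a) (enum_val b)) 0) => [->|nz].
    by rewrite scale0r msupp0.
  have [_ _ _ sab] := sr_supp F nz; rewrite msuppMCX // inE => /eqP->.
  rewrite -!mdeg_squarefree -PoszD -mdegD submK //.
  by rewrite squarefree_leE.
have aug_homog (a : 'I_#|B 0|) m : m \in msupp ((const_mx 1 : 'cV[R]_#|B 0|) a 0) ->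
    (mdeg m)%:Z = #|al (enum_val a)|%:Z.
  by rewrite mxE msupp1 inE => /eqP->; rewrite mdeg0 basis0_val (sr_al0 F) cards0.
have surj f : exists u : 'rV[R]_#|B 0|, Id (f - (u *m (const_mx 1 : 'cV[R]_#|B 0|)) 0 0).
  exists (const_mx f); rewrite augE; under eq_bigr do rewrite mxE.
  by rewrite sum_basis0 subrr; apply/IdE; apply: family_ideal0.
have exact0 (u : 'rV[R]_#|B 0|) :
    Id ((u *m (const_mx 1 : 'cV[R]_#|B 0|)) 0 0) <-> exists v, u = v *m d 0.
  split=> [/IdE Iu|[v ->]]; last first.
    apply/IdE; rewrite augE; apply: family_ideal_sum => b _; rewrite vald.
    apply: family_ideal_sum => a _; apply: family_idealM; first exact: sr_mono F.
    by rewrite basis0_val; apply: homog_diff_aug.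
  have [|||W WE] := @homog_exact (extend_row u).
  - by move=> x nx; apply: extend_row_out; apply: contra nx; rewrite inE => /andP[].
  - move=> z; rewrite extend_row_diff big1 // => a _.
    by rewrite basis0_val /D (sr_row0 F) scale0r mulr0.
  - rewrite augE in Iu; suff -> : extend_row u x0 = \sum_a u 0 a by [].
    by apply: eq_bigl => a; rewrite basis0_val eqxx.
  exists (\row_a W (enum_val a)); apply/rowP => b.
  rewrite vald -extend_row_val WE (sum_basis_left _ (enum_valP b)).
  by apply: eq_bigr => a _; rewrite mxE.
have exactS i (u : 'rV[R]_#|B i.+1|) : u *m d i = 0 <-> exists v, u = v *m d i.+1.
  split=> [ud|[v ->]]; last by rewrite -mulmxA dd mulmx0.
  have [|||W WE] := @homog_exact (extend_row u).
  - by move=> x nx; apply: extend_row_out; apply: contra nx; rewrite inE => /andP[].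
  - move=> z; rewrite extend_row_diff; case: (boolP (z \in B i)) => [zB|nz].
      by move/rowP/(_ (enum_rank_in zB z)): ud; rewrite vald mxE enum_rankK_in.
    rewrite big1 // => a _; have := enum_valP a; rewrite inE => /andP[_ /eqP ha].
    case: (eqVneq (D (enum_val a) z) 0) => [->|/homog_diff_eq0[_ Az hz _]].
      by rewrite mulr0.
    by move: nz; rewrite inE Az /=; move: hz; rewrite ha => -[<-]; rewrite eqxx.
  - rewrite extend_row_out; first exact: family_ideal0.
    have : x0 \in B 0 by rewrite in_basis0.
    by rewrite !inE => /andP[_ /eqP->]; rewrite andbF.
  exists (\row_a W (enum_val a)); apply/rowP => b.
  rewrite vald -extend_row_val WE (sum_basis_left _ (enum_valP b)).
  by apply: eq_bigr => a _; rewrite mxE.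
have minim i (a : 'I_#|B i.+1|) (b : 'I_#|B i|) : (d i a b)@_0%MM = 0.
  rewrite mxE /D mcoeffZ mcoeffX.
  case: (eqVneq (c (enum_val a) (enum_val b)) 0) => [->|nz]; first by rewrite mul0r.
  case: eqP => [E|_]; last by rewrite mulr0.
  have /negP[] := min nz; have [_ _ _ sab] := sr_supp F nz.
  rewrite eqEsubset sab andbT -squarefree_leE; apply/mnm_lepP => j.
  by move/mnmP/(_ j): E; rewrite mnmBE mnm0E => /eqP; rewrite subn_eq0.
by exists (MinimalFreeResolution homogP aug_homog surj exact0 exactS minim).
Qed.

End Homogenize.

(** * Comparison of minimal resolutions *)

Section Comparison.
Variables (K : fieldType) (N : nat).
Local Notation R := {mpoly K[N]}.
Variable I : R -> Prop.
Hypothesis I0 : I 0.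
Hypothesis ID : forall f g, I f -> I g -> I (f + g).
Hypothesis IM : forall f g, I g -> I (f * g).

(** Projectivity of free modules: images of the basis vectors are lifted one by one. *)
Lemma factor_rows m p q (A : 'M[R]_(m, p)) (B : 'M[R]_(q, p)) :
  (forall u : 'rV_m, exists v, u *m A = v *m B) -> exists P, A = P *m B.
Proof.
move=> AB; have [f fE] := fin_all_exists (fun a => AB (delta_mx 0 a)).
exists (\matrix_a f a); apply/row_matrixP => a.
by rewrite row_mul rowK -fE rowE.
Qed.

Section Lift.
Variables F G : minimal_free_resolution I.

Lemma mfr_diff_diff (H : minimal_free_resolution I) i :
  mfr_diff H i.+1 *m mfr_diff H i = 0.
Proof.
apply/row_matrixP => a; rewrite row0 row_mul; apply/mfr_exactS.
by exists (delta_mx 0 a); rewrite rowE.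
Qed.

Lemma mfr_diff_aug (H : minimal_free_resolution I) (u : 'rV_(mfr_rank H 1)) :
  I ((u *m mfr_diff H 0 *m mfr_aug H) 0 0).
Proof. by apply/mfr_exact0; exists u. Qed.

Lemma sum_in_ideal (m : nat) (u : 'rV[R]_m) (w : 'cV[R]_m) :
  (forall a, I (w a 0)) -> I ((u *m w) 0 0).
Proof. by move=> Iw; rewrite mxE; elim/big_ind: _ => // a _; apply: IM. Qed.

(** The start of a chain map over the identity of R/I. The augmentations take values in R, so they
    agree only modulo [I]. *)
Lemma chain_lift0 : exists (P0 : 'M_(mfr_rank F 0, mfr_rank G 0))
    (P1 : 'M_(mfr_rank F 1, mfr_rank G 1)),
  (forall u : 'rV_(mfr_rank F 0), I ((u *m (mfr_aug F - P0 *m mfr_aug G)) 0 0)) /\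
  mfr_diff F 0 *m P0 = P1 *m mfr_diff G 0.
Proof.
have [f fE] := fin_all_exists (fun a => mfr_aug_surj G (mfr_aug F a 0)).
pose P0 : 'M_(mfr_rank F 0, mfr_rank G 0) := \matrix_a f a.
have P0E (u : 'rV_(mfr_rank F 0)) : I ((u *m (mfr_aug F - P0 *m mfr_aug G)) 0 0).
  apply: sum_in_ideal => a; have := fE a.
  by rewrite -[f a](rowK f) -row_mul !mxE.
have [P1 P1E] : exists P1, mfr_diff F 0 *m P0 = P1 *m mfr_diff G 0.
  apply: factor_rows => u; rewrite mulmxA; apply/mfr_exact0.
  have -> : u *m mfr_diff F 0 *m P0 *m mfr_aug G = u *m mfr_diff F 0 *m mfr_aug F
      + - 1%:M *m (u *m mfr_diff F 0 *m (mfr_aug F - P0 *m mfr_aug G)).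
    by rewrite mulNmx mul1mx mulmxBr !mulmxA opprB addrC subrK.
  rewrite mxE; apply: ID; first exact: mfr_diff_aug.
  by rewrite mulNmx mul1mx mxE -mulN1r; apply: IM.
by exists P0, P1.
Qed.

Lemma chain_liftS i (P0 : 'M_(mfr_rank F i, mfr_rank G i)) P1 :
  mfr_diff F i *m P0 = P1 *m mfr_diff G i ->
  exists P2, mfr_diff F i.+1 *m P1 = P2 *m mfr_diff G i.+1.
Proof.
move=> P01; apply: factor_rows => u; rewrite mulmxA; apply/mfr_exactS.
by rewrite -mulmxA -P01 mulmxA -[u *m _ *m _]mulmxA mfr_diff_diff mulmx0 mul0mx.
Qed.

End Lift.

(** Only the data around degree [i] is carried: chain maps both ways and a homotopy [s]. The last
    equation says that the error is a cycle, and exactness turns it into the next homotopy. *)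
Lemma homotopy (F G : minimal_free_resolution I) i :
  exists (P0 : 'M_(mfr_rank F i, mfr_rank G i)) P1
         (Q0 : 'M_(mfr_rank G i, mfr_rank F i)) Q1 s,
  [/\ mfr_diff F i *m P0 = P1 *m mfr_diff G i,
      mfr_diff G i *m Q0 = Q1 *m mfr_diff F i
    & (P1 *m Q1 - 1%:M - mfr_diff F i *m s) *m mfr_diff F i = 0].
Proof.
elim: i => [|i [P0 [P1 [Q0 [Q1 [s [PE QE sE]]]]]]].
  have [P0 [P1 [P0E PE]]] := chain_lift0 F G.
  have [Q0 [Q1 [Q0E QE]]] := chain_lift0 G F.
  have [s sE] : exists s, P0 *m Q0 - 1%:M = s *m mfr_diff F 0.
    apply: factor_rows => u; apply/mfr_exact0.
    have -> : u *m (P0 *m Q0 - 1%:M) *m mfr_aug F =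
        - 1%:M *m (u *m (mfr_aug F - P0 *m mfr_aug G))
        + - 1%:M *m ((u *m P0) *m (mfr_aug G - Q0 *m mfr_aug F)).
      rewrite !mulNmx !mul1mx !mulmxBr mulmxBl !mulmxA mulmx1 !opprB.
      by rewrite [RHS]addrC addrA subrK.
    rewrite mxE; apply: ID; rewrite mulNmx mul1mx mxE -mulN1r; apply: IM; last exact: Q0E.
    exact: P0E.
  exists P0, P1, Q0, Q1, s; split=> //.
  rewrite !mulmxBl mul1mx -[_ *m s *m _]mulmxA -sE -mulmxA -QE mulmxA -PE.
  by rewrite mulmxBr mulmx1 mulmxA subrr.
have [P2 PE2] := chain_liftS PE; have [Q2 QE2] := chain_liftS QE.
have [t tE] : exists t, P1 *m Q1 - 1%:M - mfr_diff F i *m s = t *m mfr_diff F i.+1.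
  by apply: factor_rows => u; apply/mfr_exactS; rewrite -mulmxA sE mulmx0.
exists P1, P2, Q1, Q2, t; split=> //.
rewrite !mulmxBl mul1mx -[_ *m t *m _]mulmxA -tE -mulmxA -QE2 mulmxA -PE2.
rewrite !mulmxBr mulmx1 !mulmxA mfr_diff_diff mul0mx subr0.
by rewrite subrr.
Qed.

(** If the module of [G] vanishes, so does [P1 *m Q1], and minus the identity is a sum of two
    products each involving a differential of [F]. By minimality these have zero constant terms,
    whereas the diagonal of the identity has constant term 1. *)
Lemma mfr_rank_eq0 (F G : minimal_free_resolution I) i :
  mfr_rank G i.+1 = 0%N -> mfr_rank F i.+1 = 0%N.
Proof.
move=> G0; have [P0 [P1 [Q0 [Q1 [s [_ _ sE]]]]]] := homotopy F G i.
have [t tE] : exists t, P1 *m Q1 - 1%:M - mfr_diff F i *m s = t *m mfr_diff F i.+1.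
  by apply: factor_rows => u; apply/mfr_exactS; rewrite -mulmxA sE mulmx0.
have PQ : P1 *m Q1 = 0.
  by apply/matrixP => a b; rewrite !mxE big1 // => k; have := ltn_ord k; rewrite {2}G0.
apply/eqP; rewrite -leqn0 leqNgt; apply/negP => F0.
pose a : 'I_(mfr_rank F i.+1) := Ordinal F0.
have /matrixP/(_ a a) := tE; rewrite PQ !mxE eqxx => E.
have : (0 - 1%:R - \sum_j mfr_diff F i a j * s j a)@_0%MM
   = (\sum_j t a j * mfr_diff F i.+1 j a)@_0%MM by rewrite -E.
rewrite !mcoeffB mcoeff0 mcoeff1 eqxx !raddf_sum /=.
rewrite !big1 => [|j _|j _]; last 2 first.
- by rewrite (rmorphM (mcoeff 0%MM)) /= mfr_minimal mulr0.
- by rewrite (rmorphM (mcoeff 0%MM)) /= mfr_minimal mul0r oppr0.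
by move/eqP; rewrite sub0r addr0 oppr_eq0 oner_eq0.
Qed.

End Comparison.

(** * The wheel *)

(** The element of full multidegree survives pruning, so degree [b] is nonzero in the pruned
    resolution and higher degrees are zero; the comparison transfers this vanishing to all minimal
    resolutions. *)
Lemma concentrated_proj_dim (K : fieldType) (V : finType) (I : pred {set V}) Y b
    (Id : {mpoly K[#|V|]} -> Prop) :
  ~~ I set0 -> (forall f, Id f <-> family_ideal I f) ->
  concentrated K I Y b true -> proj_dim Id b.
Proof.
move=> I0 IdE [s [[X [A [h [al [c [x0 [F Fs]]]]]]] ss bY]].
have hA x : x \in A -> (h x <= b)%N /\ (al x = Y -> h x = b).
  move=> Ax; have [|? _ E] := ss (h x, al x); first by rewrite -Fs; apply/imageP; exists x.
  by split=> // /E[].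
have : (b, Y) \in s by apply: bY.
rewrite -Fs => /imageP[t At [bE YE]].
have [|A' [c' [F' A'A tA' min]]] := prune I0 F At.
  by move=> x Ax; rewrite -YE -bE => /(hA x Ax).2.
have [H HE] := exists_mfr F' IdE min.
have [Id0 IdD IdM] : [/\ Id 0, forall f g, Id f -> Id g -> Id (f + g)
    & forall f g, Id g -> Id (f * g)].
  split=> [|f g /IdE If /IdE Ig|f g /IdE Ig]; apply/IdE.
  - exact: family_ideal0.
  - exact: family_idealD.
  - by apply: family_idealM; first exact: sr_mono F.
split.
  have rb : (0 < mfr_rank H b)%N.
    by rewrite HE card_gt0; apply/set0Pn; exists t; rewrite inE tA' bE eqxx.
  pose a := Ordinal rb; exists (mfr_deg a).
  exists #|[set a' : 'I_(mfr_rank H b) | mfr_deg a' == mfr_deg a]|.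
  split; first by exists H.
  by apply/eqP; rewrite -lt0n card_gt0; apply/set0Pn; exists a; rewrite inE.
move=> i j k [G ->] nz; rewrite leqNgt; apply/negP => bi.
have HE0 : mfr_rank H i = 0%N.
  rewrite HE; apply/eqP; rewrite cards_eq0; apply/eqP/setP => x; rewrite !inE.
  apply/negbTE/negP => /andP[/(subsetP A'A)/hA[hx _] /eqP hi]; lia.
case: i => // i in bi nz HE0 *.
have G0 := mfr_rank_eq0 Id0 IdD IdM G HE0.
apply: nz; apply/eqP; rewrite cards_eq0; apply/eqP/setP => a.
by have := ltn_ord a; rewrite {2}G0.
Qed.

Lemma matching_number_le (V : finType) (e : rel V) : irreflexive e ->
  (matching_number e <= #|V|./2)%N.
Proof.
move=> irr; apply/bigmax_leqP => M /andP[/subsetP Me tM].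
have M2 A : A \in M -> #|A| = 2%N.
  move=> /Me; rewrite inE => /existsP[u /existsP[v /andP[euv /eqP->]]].
  by rewrite cards2; case: eqP euv => // ->; rewrite irr.
rewrite -(doubleK #|M|) half_leq // -muln2 -sum_nat_const.
move/eqP: tM; rewrite (eq_bigr _ M2) => ->.
exact: max_card.
Qed.

Lemma matching_number_ge (V : finType) (e : rel V) (v : nat -> V) k :
  injective_upto v k.*2 -> (forall i, (i < k)%N -> e (v i.*2) (v i.*2.+1)) ->
  (k <= matching_number e)%N.
Proof.
move=> vI ve; pose E (i : 'I_k) := [set v (val i).*2; v (val i).*2.+1].
have vE (i j : 'I_k) a b : (a < 2)%N -> (b < 2)%N ->
    v ((val i).*2 + a)%N = v ((val j).*2 + b)%N -> i = j.
  move=> a2 b2 /vI H; apply: val_inj => /=.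
  have := ltn_ord i; have := ltn_ord j => /= jk ik.
  have : ((val i).*2 + a = (val j).*2 + b)%N by apply: H => /=; lia.
  rewrite /=; lia.
have EP (i : 'I_k) z : z \in E i -> exists2 a, (a < 2)%N & z = v ((val i).*2 + a)%N.
  rewrite !inE => /orP[] /eqP->; first by exists 0%N; rewrite ?addn0.
  by exists 1%N; rewrite ?addn1.
have Ez i : v (val i).*2 \in E i by rewrite !inE eqxx.
have EI : injective E.
  move=> i j Eij; have := Ez i; rewrite Eij => /EP[a a2].
  by rewrite -[X in v X](addn0); apply: vE.
rewrite -[k]card_ord -(card_imset _ EI).
apply: leq_bigmax_cond; apply/andP; split.
  apply/subsetP => _ /imsetP[i _ ->]; rewrite inE; apply/existsP.
  exists (v (val i).*2); apply/existsP; exists (v (val i).*2.+1).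
  by rewrite ve //= eqxx.
apply/trivIsetP => _ _ /imsetP[i _ ->] /imsetP[j _ ->] nij.
apply/disjoint_notinP => z /EP[a a2 ->]; apply: contraNN nij => /EP[b b2].
by move=> /(vE _ _ _ _ a2 b2) ->.
Qed.

(* [rim n i] is the rim vertex [Some i] for [i < n] and the hub for [i >= n]. *)
Definition rim n (i : nat) : option 'I_n := insub i.

Lemma rim_eq n (j : 'I_n) i : (i < n)%N -> (Some j == rim n i) = (val j == i).
Proof. by move=> i_n; rewrite /rim insubT. Qed.

Lemma rim_neq_hub n i : (i < n)%N -> (None == rim n i) = false.
Proof. by move=> i_n; rewrite /rim insubT. Qed.

Lemma rim_hub n : rim n n = None.
Proof. by rewrite /rim insubF ?ltnn. Qed.

Lemma rim_inj n : injective_upto (rim n) n.+1.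
Proof.
move=> i j; rewrite !ltnS /rim.
case: insubP => [u _ <-|i_n]; case: insubP => [w _ <-|j_n] //; last by lia.
by move=> _ _ [->].
Qed.

Lemma rim_val n (i : 'I_n) : rim n i = Some i.
Proof. exact: valK. Qed.

Lemma matching_number_wheel n : (2 <= n)%N ->
  matching_number (wheel n) = (n.+1)./2.
Proof.
move=> n2; apply/eqP; rewrite eqn_leq; apply/andP; split.
  by have := matching_number_le (wheel_irrefl n2); rewrite card_option card_ord.
apply: (@matching_number_ge _ _ (rim n)).
  apply: injective_uptoW (@rim_inj n); lia.
move=> i ik; have i_n : (i.*2 < n)%N by lia.
rewrite -[X in rim n X]/(val (Ordinal i_n)) rim_val.
case: (ltnP i.*2.+1 n) => i1.
  by rewrite -[X in rim n X]/(val (Ordinal i1)) rim_val /= eqxx.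
(* Here [n] is odd, and the last rim vertex is matched with the hub, which is [rim n n]. *)
have -> : i.*2.+1 = n by lia.
by rewrite rim_hub.
Qed.

Lemma closed_nbhd_wheel n a b c (i : 'I_n) : (a < n)%N -> (b < n)%N -> (c < n)%N ->
  (forall j : 'I_n, wheel n (Some i) (Some j) || (j == i) =
    [|| val j == a, val j == b | val j == c]) ->
  closed_nbhd (wheel n) (Some i) = None |: [set rim n a; rim n b; rim n c].
Proof.
move=> a_n b_n c_n ijE; apply/setP => -[j|]; rewrite !inE /= ?orbT //.
by rewrite !rim_eq // -orbA -ijE orbC.
Qed.

(** A rim vertex has as closed neighborhood the hub and a window of the cycle. That of the hub is
    the whole vertex set, so its monomial is redundant. *)
Lemma wheel_family n (G : {set option 'I_n}) : (3 <= n)%N ->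
  [exists w, closed_nbhd (wheel n) w \subset G] =
  (None \in G) && cycle_family (rim n) n G.
Proof.
move=> n3; have n0 : (0 < n)%N by lia.
have n1 : (n.-1 < n)%N by lia.
have nbhd0 : closed_nbhd (wheel n) (Some (Ordinal n0)) =
    None |: [set rim n n.-1; rim n 0; rim n 1].
  apply: closed_nbhd_wheel => [|||[j j_n]]; rewrite -?val_eqE /=; lia.
have nbhd1 : closed_nbhd (wheel n) (Some (Ordinal n1)) =
    None |: [set rim n n.-2; rim n n.-1; rim n 0].
  apply: closed_nbhd_wheel => [|||[j j_n]]; rewrite -?val_eqE /=; lia.
have nbhdS i (i_n : (i.+1 < n)%N) : (i.+2 < n)%N ->
    closed_nbhd (wheel n) (Some (Ordinal i_n)) = None |: window (rim n) i.
  move=> i2; apply: closed_nbhd_wheel => [|||[j j_n]]; rewrite -?val_eqE /=; lia.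
have hubU (S : {set option 'I_n}) :
    (None |: S \subset G) = (None \in G) && (S \subset G).
  by rewrite subUset sub1set.
rewrite /cycle_family /adjoin.
apply/existsP/andP => [[[i|]]|[G0]].
- case: i => i i_n; case: (posnP i) => [i0|].
    have -> : Ordinal i_n = Ordinal n0 by apply: val_inj.
    by rewrite nbhd0 hubU => /andP[-> ->]; rewrite orbT.
  case: (eqVneq i n.-1) => [i0 _|ne].
    have -> : Ordinal i_n = Ordinal n1 by apply: val_inj.
    by rewrite nbhd1 hubU => /andP[-> ->]; rewrite orbT.
  case: i i_n ne => // i i_n ne _; have i2 : (i.+2 < n)%N by lia.
  rewrite nbhdS // hubU => /andP[-> iG]; split=> //.
  apply/orP; left; apply/orP; left; apply/existsP.
  have i0 : (i < n)%N by lia.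
  by exists (Ordinal i0); rewrite /= i2.
- have -> : closed_nbhd (wheel n) None = setT by apply/setP => -[j|]; rewrite !inE.
  by rewrite subTset => /eqP->; rewrite inE subsetT orbT.
case/orP => [/orP[/existsP[i /andP[i2 iG]]|mG]|mG].
- have i1 : (i.+1 < n)%N by lia.
  by exists (Some (Ordinal i1)); rewrite nbhdS // hubU G0.
- by exists (Some (Ordinal n1)); rewrite nbhd1 hubU G0.
by exists (Some (Ordinal n0)); rewrite nbhd0 hubU G0.
Qed.

Lemma wheel_concentrated (K : fieldType) n : (3 <= n)%N ->
  concentrated K (fun G => [exists w, closed_nbhd (wheel n) w \subset G])
    (None |: vertices (rim n) n) (cycle_pd n) true.
Proof.
move=> n3; have yI : injective_upto (rim n) n by apply: injective_uptoW (@rim_inj n).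
apply: (@eq_concentrated _ _ (fun G => (None \in G) && cycle_family (rim n) n G)).
  by move=> G; rewrite wheel_family.
apply: concentrated_hub; last first.
(* For [n = 3] all windows of the cycle are the whole triangle, and the family is that of the path
   on three vertices. *)
- have [n4|n4] := ltnP 3%N n; first exact: cycle_concentrated.
  have -> : n = 3 by lia.
  have := path_concentrated K (injective_uptoW (leqnSn _) (@rim_inj 3%N)).
  apply: eq_concentrated => G; rewrite /cycle_family /adjoin !subset3 /=.
  apply/path_familyP/orP => [[i [i3 y0 y1 y2]]|].
    right; have i0 : i = 0%N by lia.
    by move: y0 y1 y2; rewrite i0 => -> -> ->.
  case=> [/orP[/path_familyP//|]|] /and3P[*]; by exists 0%N.
- rewrite /cycle_pd; lia.
by apply/verticesP => -[i i_n] /eqP; rewrite rim_neq_hub.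
Qed.

Theorem corollary3p15 (K : fieldType) (n : nat) (hn : (3 <= n)%N) :
  proj_dim (closed_nbhd_ideal K (wheel n))
    (if (n %% 4 != 3)%N then matching_number (wheel n)
     else (matching_number (wheel n) - 1)%N).
Proof.
(* For n = 4 q + r with r = 0, 1, 2, 3, the matching number is 2 q, 2 q + 1, 2 q + 1, 2 q + 2, and
   [cycle_pd n] is 2 q, 2 q + 1, 2 q + 1, 2 q + 1. *)
have -> : (if (n %% 4 != 3)%N then matching_number (wheel n)
    else (matching_number (wheel n) - 1)%N) = cycle_pd n.
  rewrite matching_number_wheel /cycle_pd; last exact: ltnW.
  case: ifP; lia.
apply: concentrated_proj_dim (wheel_concentrated K hn).
  by apply/existsPn => w; apply/subsetPn; exists w; rewrite !inE ?eqxx.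
exact: closed_nbhd_idealE.
Qed.
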